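(* Let $k$ be an algebraically closed field. Given positive integers $c,d,n$, there exists a non-zero Lie polynomial $P$ over $k$ such that for every non-zero Lie polynomial $Q$ of degree $d$ in $n$ variables over $k$ and every Lie algebra $L$ over $k$, either $P$ is an identity on $L$ (that is, $P$ vanishes under every substitution of elements of $L$ for its variables), or the algebraic set $\{\mathbf{r}\in L^n\mid Q(\mathbf{r})=0\}$ has codimension $>c$ in $L^n$ (that is, it does not have codimension $\le c$).
   Context: $k$ is an algebraically closed field of arbitrary characteristic; Lie algebras may be infinite-dimensional. A Lie polynomial in $n$ variables is an element of the free Lie $k$-algebra on $x_1,\ldots,x_n$. Codimension: let $V$ be a (possibly infinite-dimensional) $k$-vector space and $A$ the ring of $k$-valued polynomial functions on $V$ (the $k$-algebra of functions generated by the constants and the linear functionals). For an ideal $I$ of $A$, $V(I)\subset V$ is the set of common zeros of the elements of $I$; an algebraic set in $V$ is a set of this form. An algebraic set $X\subset V$ has codimension $\le c$ if there exist a direct sum decomposition $V=V_1\oplus V_2$ with $V_2$ finite dimensional and an algebraic set $X_2\subset V_2$ of codimension at most $c$ in $V_2$ (in the usual sense, $\dim V_2-\dim X_2\le c$, the empty set having infinite codimension) such that $X\supset V_1\times X_2$. *)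

(* Defs.v *)
From HB Require Import structures.
From mathcomp Require Import all_boot all_order all_algebra generic_quotient.
From mathcomp Require Import boolp classical_sets.

Set Implicit Arguments.
Unset Strict Implicit.
Unset Printing Implicit Defensive.

Import GRing.Theory.

Local Open Scope classical_set_scope.
Local Open Scope ring_scope.
Local Open Scope quotient_scope.

Reserved Notation "[Lie x , y ]" (at level 0, format "[Lie  x ,  y ]").

HB.mixin Record Lmodule_isLieAlgebra (k : fieldType) L
    of GRing.Lmodule k L := {
  lie_bracket : L -> L -> L;
  lie_linearl : forall y (a : k) x x',
    lie_bracket (a *: x + x') y = a *: lie_bracket x y + lie_bracket x' y;
  lie_linearr : forall x (a : k) y y',
    lie_bracket x (a *: y + y') = a *: lie_bracket x y + lie_bracket x y';
  liexx : forall x, lie_bracket x x = 0;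
  lie_jacobi : forall x y z,
    lie_bracket x (lie_bracket y z) + lie_bracket y (lie_bracket z x)
      + lie_bracket z (lie_bracket x y) = 0
}.

#[short(type="lieAlgType")]
HB.structure Definition LieAlgebra (k : fieldType) :=
  { L of GRing.Lmodule k L & Lmodule_isLieAlgebra k L }.

Notation "[Lie x , y ]" := (lie_bracket x y) : ring_scope.

(* The free Lie algebra on 'I_n is the algebra of formal Lie expressions modulo
   the least congruence containing the axioms of Lie algebras. *)
Section FreeLie.
Variables (k : fieldType) (n : nat).

Inductive lie_term : Type :=
  | TVar of 'I_n
  | TZero
  | TAdd of lie_term & lie_term
  | TOpp of lie_term
  | TScale of k & lie_term
  | TBr of lie_term & lie_term.

HB.instance Definition _ := gen_eqMixin lie_term.
HB.instance Definition _ := gen_choiceMixin lie_term.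

Inductive lie_congr : lie_term -> lie_term -> Prop :=
  | congr_refl t : lie_congr t t
  | congr_sym s t : lie_congr s t -> lie_congr t s
  | congr_trans t s u : lie_congr s t -> lie_congr t u -> lie_congr s u
  | congr_add s s' t t' : lie_congr s s' -> lie_congr t t' ->
      lie_congr (TAdd s t) (TAdd s' t')
  | congr_opp s s' : lie_congr s s' -> lie_congr (TOpp s) (TOpp s')
  | congr_scale a s s' : lie_congr s s' ->
      lie_congr (TScale a s) (TScale a s')
  | congr_br s s' t t' : lie_congr s s' -> lie_congr t t' ->
      lie_congr (TBr s t) (TBr s' t')
  | congr_addA s t u : lie_congr (TAdd s (TAdd t u)) (TAdd (TAdd s t) u)
  | congr_addC s t : lie_congr (TAdd s t) (TAdd t s)
  | congr_add0 t : lie_congr (TAdd TZero t) t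
  | congr_addN t : lie_congr (TAdd (TOpp t) t) TZero
  | congr_scaleA a b t :
      lie_congr (TScale a (TScale b t)) (TScale (a * b) t)
  | congr_scale1 t : lie_congr (TScale 1 t) t
  | congr_scaleDr a s t :
      lie_congr (TScale a (TAdd s t)) (TAdd (TScale a s) (TScale a t))
  | congr_scaleDl t a b :
      lie_congr (TScale (a + b) t) (TAdd (TScale a t) (TScale b t))
  | congr_brl u a s t :
      lie_congr (TBr (TAdd (TScale a s) t) u)
                (TAdd (TScale a (TBr s u)) (TBr t u))
  | congr_brr u a s t :
      lie_congr (TBr u (TAdd (TScale a s) t))
                (TAdd (TScale a (TBr u s)) (TBr u t))
  | congr_brxx t : lie_congr (TBr t t) TZero
  | congr_jacobi s t u :
      lie_congr (TAdd (TAdd (TBr s (TBr t u)) (TBr t (TBr u s)))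
                      (TBr u (TBr s t))) TZero.

Definition lie_equiv (s t : lie_term) : bool := `[< lie_congr s t >].

Lemma lie_equiv_is_equiv : equiv_class_of lie_equiv.
Proof.
split=> [t|s t|t s u].
- by apply/asboolP; exact: congr_refl.
- by apply/asboolP/asboolP; exact: congr_sym.
- by move=> /asboolP st /asboolP tu; apply/asboolP; exact: congr_trans st tu.
Qed.

Canonical lie_equiv_equiv := EquivRelPack lie_equiv_is_equiv.
Canonical lie_equiv_encModRel := defaultEncModRel lie_equiv.

Definition freeLie := {eq_quot lie_equiv}.

HB.instance Definition _ : EqQuotient _ lie_equiv freeLie :=
  EqQuotient.on freeLie.
HB.instance Definition _ := Choice.on freeLie.

Lemma freeLie_eqP s t :
  lie_congr s t <-> \pi_freeLie s = \pi_freeLie t.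
Proof.
split=> [st|/eqP]; first by apply/eqP; rewrite piE; apply/asboolP.
by rewrite piE => /asboolP.
Qed.

Definition free_zero : freeLie := \pi_freeLie TZero.
Definition free_add (x y : freeLie) : freeLie := \pi_freeLie (TAdd (repr x) (repr y)).
Definition free_opp (x : freeLie) : freeLie := \pi_freeLie (TOpp (repr x)).
Definition free_scale (a : k) (x : freeLie) : freeLie :=
  \pi_freeLie (TScale a (repr x)).
Definition free_br (x y : freeLie) : freeLie := \pi_freeLie (TBr (repr x) (repr y)).
Definition free_var (i : 'I_n) : freeLie := \pi_freeLie (TVar i).

Lemma repr_congr t : lie_congr (repr (\pi_freeLie t)) t.
Proof. by apply/freeLie_eqP; rewrite reprK. Qed.

Lemma pi_free_add s t :
  free_add (\pi s) (\pi t) = \pi_freeLie (TAdd s t).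
Proof. by apply/freeLie_eqP/congr_add; exact: repr_congr. Qed.

Lemma pi_free_opp t : free_opp (\pi t) = \pi_freeLie (TOpp t).
Proof. by apply/freeLie_eqP/congr_opp; exact: repr_congr. Qed.

Lemma pi_free_scale a t : free_scale a (\pi t) = \pi_freeLie (TScale a t).
Proof. by apply/freeLie_eqP/congr_scale; exact: repr_congr. Qed.

Lemma pi_free_br s t : free_br (\pi s) (\pi t) = \pi_freeLie (TBr s t).
Proof. by apply/freeLie_eqP/congr_br; exact: repr_congr. Qed.

Definition pi_freeE := (pi_free_add, pi_free_opp, pi_free_scale, pi_free_br).

Lemma free_addA : associative free_add.
Proof.
elim/quotW=> s; elim/quotW=> t; elim/quotW=> u; rewrite !pi_freeE.
exact/freeLie_eqP/congr_addA.
Qed.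

Lemma free_addC : commutative free_add.
Proof.
elim/quotW=> s; elim/quotW=> t; rewrite !pi_freeE.
exact/freeLie_eqP/congr_addC.
Qed.

Lemma free_add0 : left_id free_zero free_add.
Proof.
elim/quotW=> t; rewrite /free_zero pi_freeE; exact/freeLie_eqP/congr_add0.
Qed.

Lemma free_addN : left_inverse free_zero free_opp free_add.
Proof.
elim/quotW=> t; rewrite !pi_freeE; exact/freeLie_eqP/congr_addN.
Qed.

HB.instance Definition _ := GRing.isZmodule.Build freeLie
  free_addA free_addC free_add0 free_addN.

Lemma free_scaleA a b x : free_scale a (free_scale b x) = free_scale (a * b) x.
Proof.
elim/quotW: x => t; rewrite !pi_freeE; exact/freeLie_eqP/congr_scaleA.
Qed.

Lemma free_scale1 : left_id 1 free_scale.
Proof.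
elim/quotW=> t; rewrite !pi_freeE; exact/freeLie_eqP/congr_scale1.
Qed.

Lemma free_scaleDr : right_distributive free_scale +%R.
Proof.
move=> a; elim/quotW=> s; elim/quotW=> t.
rewrite -[LHS]/(free_scale a (free_add _ _)) -[RHS]/(free_add _ _) !pi_freeE.
exact/freeLie_eqP/congr_scaleDr.
Qed.

Lemma free_scaleDl x : {morph free_scale^~ x : a b / a + b}.
Proof.
elim/quotW: x => t a b; rewrite -[RHS]/(free_add _ _) !pi_freeE.
exact/freeLie_eqP/congr_scaleDl.
Qed.

HB.instance Definition _ := GRing.Zmodule_isLmodule.Build k freeLie
  free_scaleA free_scale1 free_scaleDr free_scaleDl.

Lemma free_brl y (a : k) x x' :
  free_br (a *: x + x') y = a *: free_br x y + free_br x' y.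
Proof.
elim/quotW: y => u; elim/quotW: x => s; elim/quotW: x' => t.
rewrite -[LHS]/(free_br (free_add (free_scale _ _) _) _).
rewrite -[RHS]/(free_add (free_scale _ _) _).
move: free_add free_scale free_br pi_free_add pi_free_scale pi_free_br.
move=> fadd fscale fbr addE scaleE brE; rewrite !(addE, scaleE, brE).
exact/freeLie_eqP/congr_brl.
Qed.

Lemma free_brr x (a : k) y y' :
  free_br x (a *: y + y') = a *: free_br x y + free_br x y'.
Proof.
elim/quotW: x => u; elim/quotW: y => s; elim/quotW: y' => t.
rewrite -[LHS]/(free_br _ (free_add (free_scale _ _) _)).
rewrite -[RHS]/(free_add (free_scale _ _) _).
move: free_add free_scale free_br pi_free_add pi_free_scale pi_free_br.
move=> fadd fscale fbr addE scaleE brE; rewrite !(addE, scaleE, brE).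
exact/freeLie_eqP/congr_brr.
Qed.

Lemma free_brxx x : free_br x x = 0.
Proof.
elim/quotW: x => t; rewrite -[RHS]/free_zero pi_freeE.
exact/freeLie_eqP/congr_brxx.
Qed.

Lemma free_jacobi x y z :
  free_br x (free_br y z) + free_br y (free_br z x)
    + free_br z (free_br x y) = 0.
Proof.
elim/quotW: x => s; elim/quotW: y => t; elim/quotW: z => u.
rewrite -[LHS]/(free_add (free_add _ _) _) -[RHS]/free_zero.
move: free_add free_br pi_free_add pi_free_br => fadd fbr addE brE.
rewrite !(addE, brE).
exact/freeLie_eqP/congr_jacobi.
Qed.

HB.instance Definition _ := Lmodule_isLieAlgebra.Build k freeLie
  free_brl free_brr free_brxx free_jacobi.

Section Eval.
Variables (L : lieAlgType k) (r : 'I_n -> L).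

Fixpoint term_eval (t : lie_term) : L :=
  match t with
  | TVar i => r i
  | TZero => 0
  | TAdd s u => term_eval s + term_eval u
  | TOpp s => - term_eval s
  | TScale a s => a *: term_eval s
  | TBr s u => [Lie term_eval s, term_eval u]
  end.

Definition lie_eval (P : freeLie) : L := term_eval (repr P).

Lemma term_eval_congr s t : lie_congr s t -> term_eval s = term_eval t.
Proof.
elim=> //=; intros; try congruence.
- by rewrite addrA.
- by rewrite addrC.
- by rewrite add0r.
- by rewrite addNr.
- by rewrite scalerA.
- by rewrite scale1r.
- by rewrite scalerDr.
- by rewrite scalerDl.
- by rewrite lie_linearl.
- by rewrite lie_linearr.
- by rewrite liexx.
- by rewrite lie_jacobi.
Qed.

Lemma lie_eval_pi t : lie_eval (\pi t) = term_eval t.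
Proof. exact/term_eval_congr/repr_congr. Qed.

Lemma lie_eval_var i : lie_eval (free_var i) = r i.
Proof. exact: lie_eval_pi. Qed.

Lemma lie_eval_is_linear : linear lie_eval.
Proof.
move=> a; elim/quotW=> s; elim/quotW=> t.
rewrite -[a *: _ + _]/(free_add (free_scale _ _) _) !pi_freeE.
by rewrite !lie_eval_pi.
Qed.

HB.instance Definition _ :=
  GRing.isLinear.Build k freeLie L *:%R lie_eval lie_eval_is_linear.

Lemma lie_eval_br P Q : lie_eval [Lie P, Q] = [Lie lie_eval P, lie_eval Q].
Proof.
elim/quotW: P => s; elim/quotW: Q => t.
rewrite -[lie_bracket (\pi_freeLie s) _]/(free_br _ _).
by rewrite pi_free_br !lie_eval_pi.
Qed.

Lemma lie_eval_unique (f : {linear freeLie -> L}) :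
  (forall P Q, f [Lie P, Q] = [Lie f P, f Q]) ->
  (forall i, f (free_var i) = r i) -> f =1 lie_eval.
Proof.
move=> fbr fvar; elim/quotW; elim=> [i||s IHs t IHt|s IHs|a s IHs|s IHs t IHt].
- by rewrite lie_eval_pi fvar.
- by rewrite lie_eval_pi -[\pi_freeLie TZero]/(0 : freeLie) linear0.
- rewrite -pi_free_add -[free_add _ _]/(\pi_freeLie s + \pi_freeLie t : freeLie).
  by rewrite !linearD /= IHs IHt.
- rewrite -pi_free_opp -[free_opp _]/(- \pi_freeLie s : freeLie).
  by rewrite !linearN /= IHs.
- rewrite -pi_free_scale -[free_scale _ _]/(a *: \pi_freeLie s : freeLie).
  by rewrite !linearZ /= IHs.
- rewrite -pi_free_br -[free_br _ _]/([Lie \pi_freeLie s, \pi_freeLie t] : freeLie).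
  by rewrite fbr lie_eval_br IHs IHt.
Qed.

End Eval.

(* The grading counting letters: the least family of subspaces with the
   variables in degree 1 and [F_a, F_b] included in F_(a+b). *)
Inductive lie_homog : nat -> freeLie -> Prop :=
  | homog_var i : lie_homog 1 (free_var i)
  | homog_br a b P Q : lie_homog a P -> lie_homog b Q ->
      lie_homog (a + b) [Lie P, Q]
  | homog_zero a : lie_homog a 0
  | homog_linear a (c : k) P Q : lie_homog a P -> lie_homog a Q ->
      lie_homog a (c *: P + Q).

(* [d] is the top degree of a nonzero homogeneous component; [Q] need not be
   homogeneous. *)
Definition lie_degree (Q : freeLie) (d : nat) : Prop :=
  exists q : nat -> freeLie,
    [/\ forall i, lie_homog i (q i), Q = \sum_(i < d.+1) q i & q d != 0].

Definition is_identity (P : freeLie) (L : lieAlgType k) : Prop :=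
  forall r : 'I_n -> L, lie_eval r P = 0.

Definition solution_set (Q : freeLie) (L : lieAlgType k) :
    set {ffun 'I_n -> L} :=
  [set r | lie_eval r Q = 0].

End FreeLie.

Arguments freeLie k n : clear implicits.
Arguments is_identity {k n} P L.
Arguments solution_set {k n} Q L.

Section Subspace.
Variables (k : fieldType) (V : lmodType k) (U : submodClosed V).

(* A subspace as a vector space in its own right, so that polynomial functions
   and algebraic sets on it are the intrinsic ones. *)
Record subsp : Type := Subsp { subsp_val : V; _ : subsp_val \in U }.

HB.instance Definition _ := [isSub for subsp_val].
HB.instance Definition _ := [Choice of subsp by <:].
HB.instance Definition _ := [SubChoice_isSubLmodule of subsp by <:].

End Subspace.

Definition is_direct_sum (k : fieldType) (V : lmodType k)
    (V1 V2 : submodClosed V) : Prop :=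
  (forall v : V, exists v1 v2, [/\ v1 \in V1, v2 \in V2 & v = v1 + v2]) /\
  (forall v : V, v \in V1 -> v \in V2 -> v = 0).

Definition has_findim (k : fieldType) (W : lmodType k) (N : nat) : Prop :=
  exists e : 'I_N -> W,
    forall w : W, exists! c : {ffun 'I_N -> k}, w = \sum_i c i *: e i.

Section Zariski.
Variables (k : fieldType) (V : lmodType k).

Inductive polyfun : (V -> k) -> Prop :=
  | polyfun_cst a : polyfun (fun=> a)
  | polyfun_linear (f : {linear V -> k^o}) : polyfun f
  | polyfun_add f g : polyfun f -> polyfun g -> polyfun (fun v => f v + g v)
  | polyfun_mul f g : polyfun f -> polyfun g -> polyfun (fun v => f v * g v).

Definition polyfun_ideal (I : set (V -> k)) : Prop :=
  [/\ I `<=` polyfun,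
      I (fun=> 0),
      forall f g, I f -> I g -> I (fun v => f v + g v) &
      forall f g, polyfun f -> I g -> I (fun v => f v * g v)].

Definition zero_locus (I : set (V -> k)) : set V :=
  [set v | forall f, I f -> f v = 0].

Definition algebraic_set (X : set V) : Prop :=
  exists2 I, polyfun_ideal I & X = zero_locus I.

Definition irreducible_set (Z : set V) : Prop :=
  Z !=set0 /\
  forall A B, algebraic_set A -> algebraic_set B ->
    Z `<=` A `|` B -> Z `<=` A \/ Z `<=` B.

(* A strictly increasing chain Z_0 < ... < Z_m of irreducible closed subsets of
   X; indices above m are irrelevant. *)
Definition has_chain (X : set V) (m : nat) : Prop :=
  exists Z : nat -> set V,
    (forall i, (i <= m)%N ->
       [/\ algebraic_set (Z i), irreducible_set (Z i) & Z i `<=` X]) /\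
    (forall i, (i < m)%N -> Z i `<` Z i.+1).

Definition zariski_dim (X : set V) (m : nat) : Prop :=
  has_chain X m /\ ~ has_chain X m.+1.

(* [dim V - dim X <= c], written without truncated subtraction; the empty set
   has no [zariski_dim], hence infinite codimension. *)
Definition findim_codim_le (c : nat) (X : set V) : Prop :=
  exists N m, [/\ has_findim V N, zariski_dim X m & (N <= m + c)%N].

End Zariski.

Definition codim_le (k : fieldType) (V : lmodType k) (c : nat) (X : set V) :
    Prop :=
  exists V1 V2 : submodClosed V,
  [/\ is_direct_sum V1 V2,
      exists N, has_findim (subsp V2) N &
      exists X2 : set (subsp V2),
        [/\ algebraic_set X2, findim_codim_le c X2 &
            forall v1 x2, v1 \in V1 -> X2 x2 -> X (v1 + val x2)]].

(* Main.v *)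
From HB Require Import structures.
Require Import Defs.
From mathcomp Require Import all_boot all_order all_algebra.
From mathcomp Require Import all_fingroup generic_quotient ssrAC.
From mathcomp Require Import boolp classical_sets functions.

(** Write ad(u) for the operator z |-> [u, z].  The polynomial P is a standard
    polynomial in operators: it is the alternating sum, over all orderings, of
    the products of all the words ad(h_1) ... ad(h_d) of length d in a large
    finite alphabet of variables, applied to one further variable.  It vanishes
    as soon as these words are linearly dependent as operators
    ([standard_dependent]), and it is not zero in the free Lie algebra, because
    words of equal length can be told apart by strictly upper triangular
    matrices ([word_separation], [word_identity_neq0]).  Nothing in P depends on
    Q or L, so it remains to see that smallness of the codimension of the zero
    set of Q forces such a dependence ([words_dependent]).

    Geometry enters once ([codim_translates]): if X has codimension at most c,
    then for any finitely many points t_J there are vectors eta_0, ..., eta_c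
    such that every t_J can be moved into X by adding a combination
    y_(J,0) eta_0 + ... + y_(J,c) eta_c.  Indeed, a chain of irreducible closed
    subsets provides an irreducible Z inside X that dominates a coordinate
    subspace of codimension at most c ([indep_extend], [chain_indep]); a nonzero
    polynomial g detects points of the base over which Z has a point
    ([generic_fiber]); a common translation eta_0 moves all the t_J to where g
    does not vanish, and the remaining c vectors span the fibre direction.

    Apply this to the M^d points t_J = h_(1,J(1)) + ... + h_(d,J(d)), where J
    runs over the maps from d slots to M copies.  Expand the operator
    ad(Q(t_J + sum_i y_(J,i) eta_i)) = 0 into words.  A word of length at most d
    either uses each of the d slots exactly once, or misses a slot and then
    depends on J only through its other d - 1 values.  So the words of the
    second kind number at most a constant times M^(d-1), the constant depending
    on c, d and n only.  If M is large, some nontrivial combination of the M^d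
    relations cancels all of them, and leaves a linear relation between words of
    length d in the h_(a,j); the relation is nontrivial because distinct J and
    distinct words of Q give distinct words.

    This needs that a nonzero homogeneous Q of degree d has a nonzero expansion
    in words, in every characteristic.  Instead of embedding the free Lie
    algebra into the free associative algebra, [detected_neq0] finds for every
    nonzero Q a Lie algebra with elements r and m such that [Q(r), m] is not
    zero.  It follows the elimination method of Lazard: a Q that vanishes for
    x_0 = 0 is, up to a multiple of x_0, a polynomial of smaller degree in the
    iterated brackets ad(x_0)^e(x_i), and these take arbitrary independent values
    in a Lie algebra of sequences extended by the shift derivation. *)

Set Implicit Arguments.
Unset Strict Implicit.
Unset Printing Implicit Defensive.

Import GRing.Theory.
Local Open Scope ring_scope.

(** * The ring of functions on a vector space *)

(** An alias of V -> k that carries a nonzero commutative ring structure, as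
    polynomials and resultants require; evaluation at the origin shows 1 <> 0. *)
Definition kfun (k : fieldType) (V : lmodType k) : Type := V -> k.

Section FunctionRing.
Variables (k : fieldType) (V : lmodType k).

HB.instance Definition _ := GRing.ComPzRing.copy (kfun V) (V -> k).

Fact kfun_oner_neq0 : 1 != 0 :> kfun V.
Proof. by apply/eqP => /(congr1 (fun f : kfun V => f 0))/eqP; rewrite oner_eq0. Qed.

HB.instance Definition _ := GRing.PzSemiRing_isNonZero.Build (kfun V) kfun_oner_neq0.

Definition at_point (p : V) (f : kfun V) : k := f p.

Fact at_point_zmod p : zmod_morphism (at_point p). Proof. by []. Qed.
Fact at_point_monoid p : monoid_morphism (at_point p). Proof. by []. Qed.
HB.instance Definition _ p := GRing.isZmodMorphism.Build (kfun V) k (at_point p) (at_point_zmod p).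
HB.instance Definition _ p := GRing.isMonoidMorphism.Build (kfun V) k (at_point p) (at_point_monoid p).

Lemma horner_at (p : V) (F : {poly kfun V}) (f : kfun V) :
  F.[f] p = (map_poly (at_point p) F).[f p].
Proof. by rewrite -[f p]/(at_point p f) horner_map. Qed.

End FunctionRing.

(** The Sylvester matrix depends only on the sizes, which a morphism preserves
    as soon as it does not kill the leading coefficients. *)
Lemma resultant_map (R S : nzRingType) (f : {rmorphism R -> S}) (p q : {poly R}) :
  f (lead_coef p) != 0 -> f (lead_coef q) != 0 ->
  f (resultant p q) = resultant (map_poly f p) (map_poly f q).
Proof.
move=> fp fq; rewrite /resultant -det_map_mx /=.
have sp : size (map_poly f p) = size p by rewrite size_map_poly_id0.
have sq : size (map_poly f q) = size q by rewrite size_map_poly_id0.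
have -> : map_mx f (Sylvester_mx p q) =
  castmx (congr2 (fun a b => (a.-1 + b.-1)%N) sq sp,
          congr2 (fun a b => (a.-1 + b.-1)%N) sq sp)
    (Sylvester_mx (map_poly f p) (map_poly f q)).
  apply/matrixP=> i j; rewrite castmxE mxE !Sylvester_mxE /=.
  case: (splitP i) => i' ei; case: splitP => i'' /= ei'' /=.
  - by rewrite coef_map rmorphMn /= -ei -ei''. 
  - by exfalso; move: (ltn_ord i'); rewrite -ei ei'' sq -ltn_subRL subnn.
  - by exfalso; move: (ltn_ord i''); rewrite -ei'' ei sq -ltn_subRL subnn.
  - have <- : i' = i'' :> nat by apply: (@addnI (size q).-1); rewrite -ei ei'' sq.
    by rewrite coef_map rmorphMn.
by move: (congr2 _ _ _) => /= E; case: _ / E (E) => E; rewrite castmx_id.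
Qed.

(** * Polynomial functions in coordinates and lying over *)

Section Coordinates.
Variables (k : closedFieldType) (V : lmodType k) (N : nat).
Variables (e : 'I_N -> V) (X : 'I_N -> {linear V -> k^o}).
Hypothesis XE : forall v, v = \sum_j X j v *: e j.
Hypothesis Xe : forall i j, X i (e j) = (i == j)%:R.

Definition coord (i : 'I_N) : kfun V := X i.

(** The subalgebra generated by the coordinates whose index lies in U. *)
Inductive polyin (U : {set 'I_N}) : kfun V -> Prop :=
  | polyin_cst a : polyin U (fun=> a)
  | polyin_coord i : i \in U -> polyin U (coord i)
  | polyin_add f g : polyin U f -> polyin U g -> polyin U (f + g)
  | polyin_mul f g : polyin U f -> polyin U g -> polyin U (f * g).

Lemma polyin0 U : polyin U 0. Proof. exact: polyin_cst. Qed.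
Lemma polyin1 U : polyin U 1. Proof. exact: polyin_cst. Qed.

Lemma polyin_opp U f : polyin U f -> polyin U (- f).
Proof.
move=> Uf; have -> : - f = (fun=> -1) * f by apply/funext => v; rewrite /GRing.mul/= mulN1r.
exact/polyin_mul/Uf/polyin_cst.
Qed.

Lemma polyin_sum U I (r : seq I) (P : pred I) (F : I -> kfun V) :
  (forall i, P i -> polyin U (F i)) -> polyin U (\sum_(i <- r | P i) F i).
Proof. by move=> UF; elim/big_ind: _ => //; [exact: polyin0|exact: polyin_add]. Qed.

Lemma polyin_prod U I (r : seq I) (P : pred I) (F : I -> kfun V) :
  (forall i, P i -> polyin U (F i)) -> polyin U (\prod_(i <- r | P i) F i).
Proof. by move=> UF; elim/big_ind: _ => //; [exact: polyin1|exact: polyin_mul]. Qed.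

Lemma polyin_exp U f n : polyin U f -> polyin U (f ^+ n).
Proof.
by move=> Uf; elim: n => [|n IHn]; [exact: polyin1|rewrite exprS; exact: polyin_mul].
Qed.

Lemma polyin_det U n (A : 'M[kfun V]_n) : (forall i j, polyin U (A i j)) -> polyin U (\det A).
Proof.
move=> UA; apply: polyin_sum => s _; apply: polyin_mul; last by apply: polyin_prod.
by rewrite -signr_odd; case: (odd _); rewrite ?expr0 ?expr1; [apply: polyin_opp|]; apply: polyin1.
Qed.

Lemma polyin_subset (U W : {set _}) f : U \subset W -> polyin U f -> polyin W f.
Proof.
move=> UW; elim=> [a|i iU|g h _ Wg _ Wh|g h _ Wg _ Wh].
- exact: polyin_cst.
- by apply: polyin_coord; exact: (fintype.subsetP UW).
- exact: polyin_add.
- exact: polyin_mul.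
Qed.

Lemma polyin_eq U f v w : polyin U f -> (forall i, i \in U -> X i v = X i w) -> f v = f w.
Proof.
move=> Uf eqvw; elim: Uf => //= [g h _ Wg _ Wh|g h _ Wg _ Wh].
- by rewrite -[LHS]/(g v + h v) Wg Wh.
- by rewrite -[LHS]/(g v * h v) Wg Wh.
Qed.

Lemma polyin_polyfun U f : polyin U f -> polyfun f.
Proof.
elim=> [a|i iU|g h _ Wg _ Wh|g h _ Wg _ Wh].
- exact: polyfun_cst.
- exact: polyfun_linear.
- exact: polyfun_add.
- exact: polyfun_mul.
Qed.

Lemma polyfun_polyin f : polyfun f -> polyin [set: _]%SET f.
Proof.
elim=> [a|g|g h _ Wg _ Wh|g h _ Wg _ Wh].
- exact: polyin_cst.
- have -> : (g : kfun V) = \sum_j (fun=> g (e j)) * coord j.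
    apply/funext => v; rewrite {1}(XE v) linear_sum fct_sumE; apply: eq_bigr => j _.
    by rewrite linearZ /= mulrC.
  by apply: polyin_sum => j _; apply: polyin_mul; [exact: polyin_cst|exact/polyin_coord/finset.in_setT].
- exact: polyin_add.
- exact: polyin_mul.
Qed.

Definition coefs_in U (F : {poly kfun V}) := forall i, polyin U F`_i.

Lemma coefs_inX U : coefs_in U 'X.
Proof. by move=> i; rewrite coefX; case: eqP => _; [exact: polyin1|exact: polyin0]. Qed.

Lemma coefs_inC U a : polyin U a -> coefs_in U a%:P.
Proof. by move=> Ua i; rewrite coefC; case: eqP => _ //; exact: polyin0. Qed.

Lemma coefs_inD U F G : coefs_in U F -> coefs_in U G -> coefs_in U (F + G).
Proof. by move=> UF UG i; rewrite coefD; apply: polyin_add. Qed.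

Lemma coefs_inM U F G : coefs_in U F -> coefs_in U G -> coefs_in U (F * G).
Proof. by move=> UF UG i; rewrite coefM; apply: polyin_sum => j _; apply: polyin_mul. Qed.

Lemma coefs_inXn U n : coefs_in U 'X^n.
Proof. by move=> i; rewrite coefXn; case: eqP => _; [exact: polyin1|exact: polyin0]. Qed.

Lemma polyin_horner U F f : coefs_in U F -> polyin U f -> polyin U F.[f].
Proof.
by move=> UF Uf; rewrite horner_coef; apply: polyin_sum => i _; apply/polyin_mul/polyin_exp.
Qed.

(** Singles out one variable: a polynomial in the coordinates of j |: U is a
    one-variable polynomial in the j-th coordinate. *)
Lemma polyin_split U j f : polyin (j |: U) f -> exists2 F, coefs_in U F & f = F.[coord j].
Proof.
elim=> [a|i|g h _ [G UG ->] _ [H UH ->]|g h _ [G UG ->] _ [H UH ->]].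
- by exists ((fun=> a) : kfun V)%:P; [exact/coefs_inC/polyin_cst|rewrite hornerC].
- case/setU1P=> [->|iU]; first by exists 'X; [exact: coefs_inX|rewrite hornerX].
  by exists (coord i)%:P; [exact/coefs_inC/polyin_coord|rewrite hornerC].
- by exists (G + H); [exact: coefs_inD|rewrite hornerD].
- by exists (G * H); [exact: coefs_inM|rewrite hornerM].
Qed.

Section Zeros.
Variable Z : set V.

Definition vanish (f : kfun V) := forall z, Z z -> f z = 0.

Lemma vanishD f g : vanish f -> vanish g -> vanish (f + g).
Proof. by move=> vf vg z Zz; rewrite -[LHS]/(f z + g z) vf // vg // addr0. Qed.
Lemma vanishMl f g : vanish g -> vanish (f * g).
Proof. by move=> vg z Zz; rewrite -[LHS]/(f z * g z) vg // mulr0. Qed.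
Lemma vanishMr f g : vanish f -> vanish (f * g).
Proof. by rewrite mulrC; apply: vanishMl. Qed.

Lemma polyin_resultant U F G : coefs_in U F -> coefs_in U G -> polyin U (resultant F G).
Proof.
move=> UF UG; apply: polyin_det => i j; rewrite Sylvester_mxE.
case: (fintype.split i) => i' /=; rewrite mulrb; case: ifP => _ //; exact: polyin0.
Qed.

(** The extension step of elimination theory.  Specialising at p the
    polynomials in the j-th coordinate that vanish on Z yields an ideal of
    k[X].  If it is proper, any common root is a suitable new coordinate.  If it
    contains a nonzero constant, coming from H, then F and H + X^l F keep their
    degrees under specialisation and become coprime, so their resultant is not
    zero at p; but the resultant vanishes on Z and does not involve the j-th
    coordinate. *)
Lemma lying_over (U : {set 'I_N}) j p F :
    j \notin U -> (forall b, polyin U b -> vanish b -> b p = 0) ->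
    coefs_in U F -> vanish F.[coord j] -> lead_coef F p != 0 ->
  exists x : k, forall f, polyin (j |: U) f -> vanish f -> f (p + (x - X j p) *: e j) = 0.
Proof.
move=> jU Up UF vF aF.
pose psi := map_poly (at_point p).
pose J (h : {poly k}) := exists H, [/\ coefs_in U H, vanish H.[coord j] & h = psi H].
have JD g h : J g -> J h -> J (g + h).
  move=> [G [UG vG ->]] [H [UH vH ->]]; exists (G + H).
  split; [exact: coefs_inD|rewrite hornerD; exact: vanishD|by rewrite /psi rmorphD].
have JM g h : J h -> J (g * h).
  move=> [H [UH vH ->]].
  pose G : {poly kfun V} := map_poly (fun a : k => (fun=> a) : kfun V) g.
  have G0 : (fun=> (0 : k)) = 0 :> kfun V by [].
  exists (G * H); split.
  - by apply: coefs_inM => // i; rewrite coef_map_id0 //; exact: polyin_cst.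
  - by rewrite hornerM; apply: vanishMl.
  - rewrite /psi rmorphM; congr (_ * _); apply/polyP => i.
    by rewrite coef_map coef_map_id0.
have JF : J (psi F) by exists F.
have szF : size (psi F) = size F by rewrite /psi size_map_poly_id0.
have F0 : psi F != 0.
  by rewrite -size_poly_eq0 szF size_poly_eq0; apply: contraNneq aF => ->; rewrite lead_coef0.
have [h [Jh h0 hmin]] : exists h, [/\ J h, h != 0 &
    forall g, J g -> g != 0 -> (size h <= size g)%N].
  pose P n := `[< exists h, [/\ J h, h != 0 & size h = n] >].
  have exP : exists n, P n by exists (size (psi F)); apply/asboolP; exists (psi F).
  case: (ex_minnP exP) => n /asboolP [h [Jh h0 <-]] nmin; exists h; split=> // g Jg g0.
  by apply: nmin; apply/asboolP; exists g.
have Jdvd g : J g -> h %| g.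
  move=> Jg; rewrite /dvdp; apply: contraT => r0.
  have /hmin/(_ r0) : J (g %% h).
    have -> : g %% h = g + (- (g %/ h)) * h by rewrite {2}(divp_eq g h) mulNr addrAC subrr add0r.
    by apply: JD => //; apply: JM.
  by rewrite leqNgt ltn_modp h0.
have [/eqP/size_poly1P[c c0 hc]|/closed_rootP[x hx]] := eqVneq (size h) 1; last first.
  exists x => f /polyin_split [H UH ->] vH.
  have Xq : X j (p + (x - X j p) *: e j) = x.
    by rewrite linearD linearZ /= Xe eqxx /GRing.scale /= mulr1 addrC subrK.
  rewrite horner_at /coord Xq.
  have -> : map_poly (at_point (p + (x - X j p) *: e j)) H = psi H.
    apply/polyP => i; rewrite !coef_map; apply: polyin_eq (UH i) _ => i' i'U.
    rewrite linearD linearZ /= Xe; case: eqP => [E|_]; first by rewrite E (negbTE jU) in i'U.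
    by rewrite /GRing.scale /= mulr0 addr0.
  have Jp : J (psi H) by exists H.
  by have /dvdpP[g ->] := Jdvd _ Jp; rewrite hornerM (rootP hx) mulr0.
exfalso.
have [H [UH vH hH]] := Jh.
pose l := size H.
have {}szF1 : (1 < size F)%N.
  rewrite ltnNge; apply/negP => /size1_polyC FC.
  move: aF; rewrite FC lead_coefC; apply/negP; rewrite negbK; apply/eqP; apply: Up => //.
  by move: vF; rewrite {1}FC hornerC.
(* Adding X^l F to H makes the leading coefficient that of F, which survives
   specialisation at p, whereas H itself drops to a constant. *)
pose G := H + 'X^l * F.
have F0' : F != 0 by rewrite -size_poly_gt0 ltnW.
have szXF : size ('X^l * F) = (l + size F)%N.
  by rewrite mulrC size_mulXn.
have ltHF : (size H < size ('X^l * F)%R)%N by rewrite szXF -addn1 leq_add2l ltnW.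
have lG : lead_coef G = lead_coef F.
  by rewrite /G addrC lead_coefDl // mulrC lead_coef_Mmonic ?monicXn.
have szG : (1 < size G)%N.
  by rewrite /G addrC size_polyDl // szXF (leq_trans szF1) // leq_addl.
have UG : coefs_in U G by apply: coefs_inD => //; apply: coefs_inM => //; exact: coefs_inXn.
have vG : vanish G.[coord j] by rewrite hornerD hornerM; apply: vanishD => //; exact: vanishMl.
have [uv _ uvE] := resultant_in_ideal szF1 szG.
have vR : vanish (resultant F G).
  have -> : resultant F G = ((resultant F G)%:P).[coord j] by rewrite hornerC.
  by rewrite uvE hornerD !hornerM; apply: vanishD; apply: vanishMl.
have := Up _ (polyin_resultant UF UG) vR.
rewrite -[LHS]/(at_point p (resultant F G)) resultant_map ?lG // => /eqP.
rewrite resultant_eq0 -/psi => gcd1.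
have : size (gcdp (psi F) (psi G)) == 1.
  rewrite -/(coprimep _ _) /G /psi rmorphD rmorphM /= -/psi -hH hc.
  by rewrite addrC coprimep_addl_mul -alg_polyC coprimepZr ?coprimep1.
by move/eqP => E; rewrite E in gcd1.
Qed.

End Zeros.
End Coordinates.

(** * Polynomial functions and irreducible sets *)

Section PolyFun.
Variables (k : closedFieldType) (V : lmodType k).

Lemma polyfun_line (f : V -> k) : polyfun f -> forall u v : V,
  exists q : {poly k}, forall s, f (u + s *: v) = q.[s].
Proof.
move=> pf_f u v; elim: pf_f => [a|g|g h _ [p Hp] _ [q Hq]|g h _ [p Hp] _ [q Hq]].
- by exists a%:P => s; rewrite hornerC.
- exists ((g u)%:P + (g v) *: 'X) => s.
  by rewrite linearD linearZ /= hornerD hornerC hornerZ hornerX mulrC.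
- by exists (p + q) => s; rewrite Hp Hq hornerD.
- by exists (p * q) => s; rewrite Hp Hq hornerM.
Qed.


Lemma poly_nonroot (q : {poly k}) : q != 0 -> exists s, q.[s] != 0.
Proof.
move=> q0; have /closed_nonrootP[s] := q0; by exists s.
Qed.

(** Restrict to the line through a point where f is not zero and a point where
    g is not zero; the field is infinite. *)
Lemma polyfun_mul_neq0 (f g : V -> k) u v : polyfun f -> polyfun g ->
  f u != 0 -> g v != 0 -> exists w, f w * g w != 0.
Proof.
move=> pf_f pf_g fu gv.
have [p Hp] := polyfun_line pf_f u (v - u).
have [q Hq] := polyfun_line pf_g u (v - u).
have p0 : p != 0.
  by apply: contraNneq fu => p0; rewrite -[u]addr0 -(scale0r (v - u)) Hp p0 horner0.
have q0 : q != 0.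
  by apply: contraNneq gv => q0; rewrite -[v](subrK u) addrC -(scale1r (v - u)) Hq q0 horner0.
have [s] := poly_nonroot (mulf_neq0 p0 q0).
by rewrite hornerM -Hp -Hq; exists (u + s *: (v - u)).
Qed.

Lemma polyfun_prod_neq0 (I : Type) (r : seq I) (f : I -> V -> k) :
  (forall i, polyfun (f i)) -> (forall i, exists v, f i v != 0) ->
  exists v, forall P : pred I, \prod_(i <- r | P i) f i v != 0.
Proof.
move=> pf_f f0.
suff [g [pf_g [v gv] gE]] : exists g : V -> k, [/\ polyfun g, exists v, g v != 0 &
    forall v, g v != 0 -> forall P : pred I, \prod_(i <- r | P i) f i v != 0].
  by exists v; apply: gE.
elim: r => [|i r [g [pf_g [v gv] gE]]].
  exists (fun=> 1); split; [exact: polyfun_cst|by exists 0; exact: oner_neq0|].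
  by move=> v _ P; rewrite big_nil oner_neq0.
have [u fu] := f0 i.
have [w fgw] := polyfun_mul_neq0 (pf_f i) pf_g fu gv.
exists (fun v => f i v * g v); split; [exact: polyfun_mul|by exists w|].
move=> x; rewrite mulf_eq0 negb_or => /andP[fx /gE gx P].
by rewrite big_cons; case: ifP => // _; rewrite mulf_neq0.
Qed.

Lemma algebraic_hypersurface (f : V -> k) : polyfun f ->
  algebraic_set [set v | f v = 0]%classic.
Proof.
move=> pf_f; exists [set g | exists2 h, polyfun h & g = fun v => h v * f v]%classic.
  split.
  - by move=> _ [h ph ->]; exact: polyfun_mul.
  - by exists (fun=> 0); [exact: polyfun_cst|apply/funext => v; rewrite mul0r].
  - move=> _ _ [g pg ->] [h ph ->]; exists (fun v => g v + h v); first exact: polyfun_add.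
    by apply/funext => v; rewrite mulrDl.
  - move=> g _ pg [h ph ->]; exists (fun v => g v * h v); first exact: polyfun_mul.
    by apply/funext => v; rewrite mulrA.
apply/seteqP; split=> v /=.
  by move=> fv _ [h _ ->]; rewrite fv mulr0.
move/(_ f); apply; exists (fun=> 1); first exact: polyfun_cst.
by apply/funext => w; rewrite mul1r.
Qed.

(** Functions vanishing on an irreducible set form a prime ideal: cover Z by two
    hypersurfaces. *)
Lemma irreducible_prime (Z : set V) f g : irreducible_set Z ->
  polyfun f -> polyfun g -> vanish Z (f * g : kfun V) -> vanish Z f \/ vanish Z g.
Proof.
move=> [_ irrZ] pf_f pf_g vfg.
apply: (irrZ _ _ (algebraic_hypersurface pf_f) (algebraic_hypersurface pf_g)).
move=> z /vfg /eqP; rewrite -[_ z]/(f z * g z) mulf_eq0 => /orP[]/eqP; by [left|right].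
Qed.

Lemma algebraic_separate (Y Z : set V) : algebraic_set Y -> (Y `<` Z)%classic ->
  exists f : V -> k, [/\ polyfun f, vanish Y f & ~ vanish Z f].
Proof.
move=> [I [Ip _ _ _] ->] [_ nsub]; apply: contrapT => nex; apply: nsub => z Zz f If.
apply: contrapT => fz; apply: nex; exists f; split; first exact: Ip.
  by move=> y; apply.
by move=> /(_ z Zz).
Qed.

End PolyFun.

(** * Algebraic independence along chains of irreducible sets *)

Section Independence.
Variables (k : closedFieldType) (V : lmodType k) (N : nat).
Variables (e : 'I_N -> V) (X : 'I_N -> {linear V -> k^o}).
Hypothesis XE : forall v, v = \sum_j X j v *: e j.
Hypothesis Xe : forall i j, X i (e j) = (i == j)%:R.

Local Notation polyin := (polyin X).
Local Notation coefs_in := (coefs_in X).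
Local Notation coord := (coord X).

(** Algebraic independence of the coordinates of T modulo the ideal of Z. *)
Definition indep (T : {set 'I_N}) (Z : set V) :=
  forall b, polyin T b -> vanish Z b -> b = 0.

Lemma coefs_in_opp T F : coefs_in T F -> coefs_in T (- F).
Proof. by move=> TF i; rewrite coefN; apply: polyin_opp. Qed.

Lemma coefs_in_det T n (A : 'M[{poly kfun V}]_n) :
  (forall i j, coefs_in T (A i j)) -> coefs_in T (\det A).
Proof.
move=> TA; rewrite /determinant; elim/big_ind: _ => [|F G|s _].
- by move=> i; rewrite coef0; exact: polyin0.
- exact: coefs_inD.
- apply: coefs_inM.
    by rewrite -signr_odd; case: (odd _); rewrite ?expr0 ?expr1;
      [apply: coefs_in_opp|]; apply/coefs_inC/polyin1.
  elim/big_ind: _ => [|F G|i _] //; last exact: coefs_inM.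
  exact/coefs_inC/polyin1.
Qed.

Lemma polyin_mul_neq0 T f g : polyin T f -> polyin T g -> f != 0 -> g != 0 -> f * g != 0.
Proof.
have ex (h : kfun V) : h != 0 -> exists v, h v != 0.
  move=> h0; apply: contrapT => nex; case/eqP: h0; apply/funext => v.
  by apply: contrapT => /eqP hv; apply: nex; exists v.
move=> /polyin_polyfun pf_f /polyin_polyfun pf_g /ex[u fu] /ex[v gv].
have [w] := polyfun_mul_neq0 pf_f pf_g fu gv.
by apply: contraNneq => fg0; rewrite -[_ * _]/((f * g) w) fg0.
Qed.

Lemma dependence_relation T Z j : ~ indep (j |: T) Z ->
  exists F, [/\ coefs_in T F, F != 0 & vanish Z F.[coord j]].
Proof.
move=> nind; apply: contrapT => nex; apply: nind => b /polyin_split[F TF bE] vb.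
apply: contrapT => /eqP b0; apply: nex; exists F; split=> //; last by rewrite -bE.
by apply: contraNneq b0 => F0; rewrite bE F0 horner0.
Qed.

Lemma vanish_sum Z I (r : seq I) (P : pred I) (F : I -> kfun V) :
  (forall i, P i -> vanish Z (F i)) -> vanish Z (\sum_(i <- r | P i) F i).
Proof. by move=> vF; elim/big_ind: _ => //; exact: vanishD. Qed.

Section Algebraic.
Variables (Z : set V) (T : {set 'I_N}).
Hypothesis Tmax : forall j, j \notin T -> ~ indep (j |: T) Z.

Section Basis.
Variables (E : nat) (E0 : (0 < E)%N).
Let Idx := {ffun 'I_N -> 'I_E}.
Let mon (a : Idx) : kfun V := \prod_j coord j ^+ a j.

Let cong (f g : kfun V) := vanish Z (f - g).

Let congD f g f' g' : cong f f' -> cong g g' -> cong (f + g) (f' + g').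
Proof. by move=> ff gg; rewrite /cong opprD addrACA; apply: vanishD. Qed.
Let congM f g f' : cong f f' -> cong (g * f) (g * f').
Proof. by move=> ff; rewrite /cong -mulrBr; apply: vanishMl. Qed.
Let cong_refl f : cong f f. Proof. by rewrite /cong subrr. Qed.
Let cong_trans g f h : cong f g -> cong g h -> cong f h.
Proof. by move=> fg gh; rewrite /cong -(subrK g f) -addrA; apply: vanishD. Qed.
Let cong_sum (I : finType) (F G : I -> kfun V) :
  (forall i, cong (F i) (G i)) -> cong (\sum_i F i) (\sum_i G i).
Proof. by move=> FG; rewrite /cong -sumrB; apply: vanish_sum => i _; apply: FG. Qed.

(** Up to a denominator b, multiplication by f preserves, modulo the ideal of Z,
    the module over the polynomials in T spanned by the monomials with all
    exponents below E. *)
Definition module_stable (f : kfun V) := exists b (C : Idx -> Idx -> kfun V),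
  [/\ polyin T b, b != 0, forall x y, polyin T (C x y) &
      forall x, cong (b * f * mon x) (\sum_y C x y * mon y)].

Let mon_delta (h : kfun V) x : \sum_y (h * (y == x)%:R) * mon y = h * mon x.
Proof.
rewrite (bigD1 x) //= eqxx mulr1 big1 ?addr0 // => y /negbTE->.
by rewrite mulr0 mul0r.
Qed.

Let polyin_natb (b : bool) : polyin T b%:R.
Proof. by case: b; [exact: polyin1|exact: polyin0]. Qed.

Lemma module_stable_base f : polyin T f -> module_stable f.
Proof.
move=> Tf; exists 1, (fun x y => f * (y == x)%:R); split; rewrite ?oner_neq0 //.
- exact: polyin1.
- by move=> x y; apply: polyin_mul.
- by move=> x; rewrite mon_delta mul1r.
Qed.

Lemma module_stableD f g : module_stable f -> module_stable g -> module_stable (f + g).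
Proof.
move=> [b [B [Tb b0 TB Bf]]] [c [C [Tc c0 TC Cg]]].
exists (b * c), (fun x y => c * B x y + b * C x y); split.
- exact: polyin_mul.
- exact: polyin_mul_neq0 Tb Tc _ _.
- by move=> x y; apply: polyin_add; apply: polyin_mul.
move=> x; have -> : b * c * (f + g) * mon x = c * (b * f * mon x) + b * (c * g * mon x).
  by rewrite !mulrA (mulrC c b) -mulrDl -mulrDr.
have -> : \sum_y (c * B x y + b * C x y) * mon y =
    c * (\sum_y B x y * mon y) + b * (\sum_y C x y * mon y).
  by rewrite !mulr_sumr -big_split; apply: eq_bigr => y _; rewrite mulrDl !mulrA.
by apply: congD; apply: congM.
Qed.

Lemma module_stableM f g : module_stable f -> module_stable g -> module_stable (f * g).
Proof.
move=> [b [B [Tb b0 TB Bf]]] [c [C [Tc c0 TC Cg]]].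
exists (b * c), (fun x z => \sum_y C x y * B y z); split.
- exact: polyin_mul.
- exact: polyin_mul_neq0 Tb Tc _ _.
- by move=> x y; apply: polyin_sum => z _; apply: polyin_mul.
move=> x; have -> : b * c * (f * g) * mon x = b * f * (c * g * mon x).
  by rewrite mulrACA !mulrA.
apply: cong_trans (congM _ (Cg x)) _.
have -> : \sum_z (\sum_y C x y * B y z) * mon z =
    \sum_y C x y * (\sum_z B y z * mon z).
  under [LHS]eq_bigr do rewrite mulr_suml.
  rewrite exchange_big; apply: eq_bigr => y _.
  by rewrite mulr_sumr; apply: eq_bigr => z _; rewrite mulrA.
rewrite mulr_sumr; apply: cong_sum => y.
by rewrite mulrCA; apply: congM.
Qed.

(** A relation F of degree less than E, multiplied by a power of the coordinate,
    rewrites its E-th power; lower powers need no rewriting. *)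
Lemma module_stable_coord j F : coefs_in T F -> F != 0 -> vanish Z F.[coord j] ->
  (size F <= E)%N -> module_stable (coord j).
Proof.
move=> TF F0 vF sF.
pose a := lead_coef F.
have Ta : polyin T a by exact: TF.
have a0 : a != 0 by rewrite lead_coef_eq0.
pose upd (x : Idx) i : Idx := [ffun l => if l == j then i else x l].
pose mon' (x : Idx) : kfun V := \prod_(l | l != j) coord l ^+ x l.
have monE x : mon x = coord j ^+ x j * mon' x by rewrite /mon (bigD1 j).
have monU x i : mon (upd x i) = coord j ^+ i * mon' x.
  rewrite monE ffunE eqxx; congr (_ * _).
  by apply: eq_bigr => l /negbTE lj; rewrite ffunE lj.
have [g [Tg gE]] : exists g : Idx -> 'I_E -> kfun V,
    (forall (x : Idx) i, polyin T (g x i)) /\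
    forall x : Idx, cong (a * coord j ^+ (x j).+1) (\sum_i g x i * coord j ^+ i).
  suff /choice[g gP] : forall x : Idx, exists g : 'I_E -> kfun V,
      (forall i, polyin T (g i)) /\ cong (a * coord j ^+ (x j).+1) (\sum_i g i * coord j ^+ i).
    by exists g; split=> x; case: (gP x).
  move=> x; have [ltxE|lexE] := ltnP (x j).+1 E.
    exists (fun i => a * (i == Ordinal ltxE)%:R); split; first by move=> i; apply: polyin_mul.
    rewrite (bigD1 (Ordinal ltxE)) //= eqxx mulr1 big1 ?addr0 // => i /negbTE ->.
    by rewrite mulr0 mul0r.
  have xE : (x j).+1 = E by apply/eqP; rewrite eqn_leq ltn_ord.
  pose G := F * 'X^(E.+1 - size F).
  have TG : coefs_in T G by apply: coefs_inM => //; exact: coefs_inXn.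
  have sG : size G = E.+1 by rewrite size_mulXn // subnK // leqW.
  have lG : G`_E = a.
    by rewrite -[E]/(E.+1.-1) -sG -/(lead_coef G) lead_coef_Mmonic // monicXn.
  have vG : vanish Z G.[coord j] by rewrite hornerM; apply: vanishMr.
  exists (fun i => - G`_i); split; first by move=> i; apply: polyin_opp.
  rewrite xE /cong; move: vG; rewrite horner_coef sG big_ord_recr /= lG addrC.
  by under [X in _ - X]eq_bigr do rewrite mulNr; rewrite sumrN opprK.
exists a, (fun x y => \sum_i g x i * (y == upd x i)%:R); split=> //.
  by move=> x y; apply: polyin_sum => i _; apply: polyin_mul.
move=> x; rewrite monE mulrA -[a * _ * _]mulrA -exprS mulrC.
apply: cong_trans (congM _ (gE x)) _.
have -> : \sum_y (\sum_i g x i * (y == upd x i)%:R) * mon y =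
          \sum_i g x i * mon (upd x i).
  under eq_bigr do rewrite mulr_suml.
  by rewrite exchange_big; apply: eq_bigr => i _; rewrite mon_delta.
rewrite mulr_sumr; apply: cong_sum => i.
by rewrite monU mulrCA [mon' x * _]mulrC.
Qed.

(** The determinant trick: the characteristic polynomial of the matrix of b f
    annihilates b f, because the monomial 1 belongs to the spanning family. *)
Lemma module_stable_monic f : module_stable f ->
  exists b G, [/\ polyin T b, b != 0, coefs_in T G, G \is monic & vanish Z G.[b * f]].
Proof.
move=> [b [C [Tb b0 TC Cf]]].
pose M : 'M[kfun V]_#|Idx| := \matrix_(i, j) C (enum_val i) (enum_val j).
exists b, (char_poly M); split=> //.
- apply: coefs_in_det => i j; rewrite !mxE; apply: coefs_inD.
    by rewrite -mulr_natr; apply: coefs_inM; [exact: coefs_inX|case: (i == j); apply/coefs_inC; [exact: polyin1|exact: polyin0]].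
  by apply: coefs_in_opp; apply: coefs_inC.
- exact: char_poly_monic.
pose A : 'M[kfun V]_#|Idx| := (b * f)%:M - M.
have -> : (char_poly M).[b * f] = \det A.
  rewrite /char_poly -[_.[_]]/(horner_eval (b * f) _) -det_map_mx.
  congr (\det _); apply/matrixP => i j; rewrite !mxE /= /horner_eval hornerD hornerN hornerC.
  by rewrite hornerMn hornerX.
pose v : 'cV[kfun V]_#|Idx| := \col_i mon (enum_val i).
have vA i : vanish Z ((A *m v) i 0).
  rewrite mulmxBl mul_scalar_mx mxE; have := Cf (enum_val i); rewrite /cong !mxE.
  set S := \sum_y _; suff -> : \sum_j M i j * v j 0 = S by [].
  by rewrite /S (reindex _ (onW_bij _ (@enum_val_bij Idx))); apply: eq_bigr => j _; rewrite !mxE.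
pose i0 := enum_rank ([ffun=> Ordinal E0] : Idx).
have v1 : v i0 0 = 1 by rewrite mxE enum_rankK /mon big1 // => l _; rewrite ffunE expr0.
have <- : (\adj A *m (A *m v)) i0 0 = \det A.
  by rewrite mulmxA mul_adj_mx mul_scalar_mx mxE v1 mulr1.
by rewrite mxE; apply: vanish_sum => i _; apply: vanishMl.
Qed.

End Basis.

(** When T is a maximal independent set, every coordinate, hence every
    polynomial function, is integral over the polynomials in T up to a
    denominator. *)
Lemma algebraic_monic f : polyfun f ->
  exists b G, [/\ polyin T b, b != 0, coefs_in T G, G \is monic & vanish Z G.[b * f : kfun V]].
Proof.
move=> /(polyfun_polyin XE) pf_f.
have /choice[F FP] : forall j, exists F, j \notin T ->
    [/\ coefs_in T F, F != 0 & vanish Z F.[coord j]].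
  by move=> j; case: (boolP (j \in T)) => [jT|/Tmax/dependence_relation[F ?]]; [exists 0|exists F].
pose E := (\max_j size (F j)).+1.
apply: (@module_stable_monic E (ltn0Sn _)).
elim: {f} pf_f => [a|i _|f g _ Sf _ Sg|f g _ Sf _ Sg].
- exact/module_stable_base/polyin_cst.
- have [iT|/FP[TF F0 vF]] := boolP (i \in T); first exact/module_stable_base/polyin_coord.
  by apply: module_stable_coord TF F0 vF _; rewrite leqW // leq_bigmax.
- exact: module_stableD.
- exact: module_stableM.
Qed.

End Algebraic.

(** Dimension grows along strict inclusions.  Otherwise T would be a
    transcendence basis on Z too; a function h vanishing on Y but not on Z would
    satisfy a relation G(h) = 0 over the polynomials in T, whose constant term is
    not zero after division by powers of h, and this constant term would be a
    relation between the coordinates of T on Y. *)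
Lemma indep_extend (Y Z : set V) T : algebraic_set Y -> irreducible_set Z ->
  (Y `<` Z)%classic -> indep T Y -> exists2 j, j \notin T & indep (j |: T) Z.
Proof.
move=> algY irrZ YZ indT; apply: contrapT => nex.
have Tmax j : j \notin T -> ~ indep (j |: T) Z by move=> jT indj; apply: nex; exists j.
have vYZ f : vanish Z f -> vanish Y f by move=> vf z Yz; apply/vf/(properW YZ).
have [f [pf_f vYf nvf]] := algebraic_separate algY YZ.
have [b [G [Tb b0 TG Gm vG]]] := algebraic_monic Tmax pf_f.
pose h : kfun V := b * f.
have pf_h : polyfun h by apply: polyfun_mul => //; exact: polyin_polyfun Tb.
have vYh : vanish Y h by apply: vanishMl.
have nvh : ~ vanish Z h.
  move=> /(irreducible_prime irrZ (polyin_polyfun Tb) pf_f) [vb|//].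
  by move/eqP: b0; apply; apply: indT => //; exact: vYZ.
have {G Gm TG vG} [G [TG G0 vG]] : exists G, [/\ coefs_in T G, G != 0 & vanish Z G.[h]].
  by exists G; split=> //; exact: monic_neq0.
have [n] : exists n, (size G <= n)%N by exists (size G).
elim: n G TG G0 vG => [|n IHn] G TG G0 vG sG.
  by move: G0; rewrite -size_poly_leq0 sG.
have [G0z|G0nz] := eqVneq G`_0 0.
  have GE : G = drop_poly 1 G * 'X.
    by rewrite -[LHS](poly_take_drop 1) expr1 [take_poly 1 G](_ : _ = 0) ?add0r //;
       apply/polyP => i; rewrite coef_take_poly coef0; case: i.
  have D0 : drop_poly 1 G != 0 by apply: contraNneq G0 => D0; rewrite GE D0 mul0r.
  have TD : coefs_in T (drop_poly 1 G) by move=> i; rewrite coef_drop_poly; apply: TG.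
  apply: (IHn _ TD D0); last by rewrite size_drop_poly leq_subLR.
  have vDh : vanish Z ((drop_poly 1 G).[h] * h) by rewrite -hornerMX -GE.
  have pf_D : polyfun (drop_poly 1 G).[h].
    apply: (@polyin_polyfun _ _ _ X [set: _]%SET); apply: polyin_horner; last exact: polyfun_polyin.
    by move=> i; apply: polyin_subset (TD i); apply: finset.subsetT.
  by have [] := irreducible_prime irrZ pf_D pf_h vDh.
move/eqP: G0nz; case; apply: indT; first exact: TG.
move=> y Yy; have := vYZ _ vG y Yy.
rewrite horner_at (vYh y Yy) horner_coef0 coef_map; exact.
Qed.

End Independence.

(** * Sets of small codimension meet small-dimensional translates *)

Lemma findim_coordinates (k : fieldType) (V : lmodType k) N : has_findim V N ->
  exists (e : 'I_N -> V) (X : 'I_N -> {linear V -> k^o}),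
    (forall v, v = \sum_j X j v *: e j) /\ (forall i j, X i (e j) = (i == j)%:R).
Proof.
move=> [e eP].
have /choice[c cE] : forall v, exists c : {ffun 'I_N -> k}, v = \sum_i c i *: e i.
  by move=> v; have [c [cE _]] := eP v; exists c.
have cU v (f : 'I_N -> k) : v = \sum_i f i *: e i -> forall i, c v i = f i.
  move=> vE i; have [c' [_ c'U]] := eP v.
  rewrite -(c'U _ (cE v)) (c'U [ffun i => f i]) ?ffunE //.
  by under eq_bigr do rewrite ffunE.
have cL i : linear (fun v => c v i : k^o).
  move=> a u v; apply: (cU _ (fun i => a * c u i + c v i)).
  rewrite {1}(cE u) {1}(cE v) scaler_sumr -big_split; apply: eq_bigr => j _.
  by rewrite /= scalerA -scalerDl.
exists e, (fun i => HB.pack_for {linear V -> k^o} (fun v => c v i : k^o)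
  (GRing.isLinear.Build k V k^o *:%R _ (cL i))); split=> [v|i j] /=; first exact: cE.
apply: (cU _ (fun i => (i == j)%:R)).
rewrite (bigD1 j) //= eqxx scale1r big1 ?addr0 // => l /negbTE ->.
by rewrite scale0r.
Qed.

Section Fibers.
Variables (k : closedFieldType) (V : lmodType k) (N : nat).
Variables (e : 'I_N -> V) (X : 'I_N -> {linear V -> k^o}).
Hypothesis XE : forall v, v = \sum_j X j v *: e j.
Hypothesis Xe : forall i j, X i (e j) = (i == j)%:R.

Local Notation polyin := (polyin X).
Local Notation coefs_in := (coefs_in X).
Local Notation coord := (coord X).

Lemma chain_indep (Z : nat -> set V) m :
    (forall i, (i <= m)%N -> algebraic_set (Z i) /\ irreducible_set (Z i)) ->
    (forall i, (i < m)%N -> (Z i `<` Z i.+1)%classic) ->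
  exists2 T, indep X T (Z m) & (m <= #|T|)%N.
Proof.
elim: m => [|m IHm] ZP Zlt.
  have [_ [[z Zz] _]] := ZP 0 isT.
  exists finset.set0 => // b b0 vb; apply/funext => v; rewrite -[RHS](vb z Zz).
  by apply: polyin_eq b0 _ => i; rewrite finset.in_set0.
have [i im|i im|T indT mT] := IHm; [exact/ZP/leqW|exact/Zlt/leqW|].
have [] := indep_extend XE (ZP m (leqnSn m)).1 (ZP m.+1 (leqnn _)).2 (Zlt m (leqnn _)) indT.
by move=> j jT indj; exists (j |: T) => //; rewrite cardsU1 jT ltnS.
Qed.

Lemma indep_max Z T : indep X T Z -> exists T',
  [/\ indep X T' Z, (#|T| <= #|T'|)%N & forall j, j \notin T' -> ~ indep X (j |: T') Z].
Proof.
move=> indT.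
pose P (U : {set 'I_N}) := `[< indep X U Z >].
have PT : P T by apply/asboolP.
have [T' /asboolP indT' maxT'] := arg_maxnP (fun U : {set 'I_N} => #|U|) PT.
exists T'; split=> // [|j jT' /asboolP indj]; first exact: maxT'.
by have := maxT' _ indj; rewrite /= cardsU1 jT' ltnn.
Qed.

(** The functions g_j are the leading coefficients of relations for the
    coordinates outside T; where none of them vanishes, these coordinates are
    found one at a time by lying over. *)
Lemma generic_fiber Z T : algebraic_set Z -> indep X T Z ->
    (forall j, j \notin T -> ~ indep X (j |: T) Z) ->
  exists g : 'I_N -> kfun V,
    [/\ forall j, polyfun (g j), forall j, exists v, g j v != 0 &
      forall t, (forall j, g j t != 0) -> exists2 z, Z z & forall i, i \in T -> X i z = X i t].
Proof.
move=> [I [Ip _ _ _] ZE] indT Tmax.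
have /choice[F FP] : forall j, exists F, j \notin T ->
    [/\ coefs_in T F, F != 0 & vanish Z F.[coord j]].
  by move=> j; case: (boolP (j \in T)) => [jT|/Tmax/dependence_relation[F ?]]; [exists 0|exists F].
exists (fun j => if j \in T then 1 else lead_coef (F j)); split.
- move=> j; case: ifPn => [_|/FP[TF _ _]]; first exact: polyfun_cst.
  exact: polyin_polyfun (TF _).
- move=> j; case: ifPn => [_|/FP[TF F0 _]]; first by exists 0; apply: oner_neq0.
  apply: contrapT => nex; case/eqP: F0; apply/eqP; rewrite -lead_coef_eq0; apply/eqP/funext => v.
  by apply: contrapT => /eqP Fv; apply: nex; exists v.
move=> t gt.
have main (s : seq 'I_N) : uniq s -> (forall j, j \in s -> j \notin T) ->
    exists p, (forall i, i \in T -> X i p = X i t) /\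
      forall f, polyin (T :|: [set j in s]) f -> vanish Z f -> f p = 0.
  elim: s => [|j s IHs] /=.
    move=> _ _; exists t; split=> // f.
    have -> : T :|: [set j in [::]] = T by apply/setP => i; rewrite !inE orbF.
    by move=> Tf vf; rewrite (indT f Tf vf).
  move=> /andP[js us] sT; have [|p [pT pI]] := IHs us.
    by move=> i si; apply: sT; rewrite inE si orbT.
  have jT : j \notin T by apply: sT; rewrite inE eqxx.
  have [TF F0 vF] := FP j jT.
  have jU : j \notin T :|: [set j in s] by rewrite !inE negb_or jT.
  have UF : coefs_in (T :|: [set j in s]) (F j).
    by move=> i; apply: polyin_subset (TF i); apply: finset.subsetUl.
  have Fp : lead_coef (F j) p != 0.
    by have := gt j; rewrite (negbTE jT); congr (_ != _); apply: polyin_eq (TF _) _ => i /pT.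
  have [x xP] := lying_over Xe jU pI UF vF Fp.
  exists (p + (x - X j p) *: e j); split=> [i iT|f].
    have ij : i != j by apply/eqP => ij; rewrite -ij iT in jT.
    by rewrite linearD linearZ /= Xe (negbTE ij) pT // /GRing.scale /= mulr0 addr0.
  have -> : T :|: [set i in j :: s] = j |: (T :|: [set i in s]).
    by apply/setP => i; rewrite !inE orbCA.
  exact: xP.
have [|j|p [pT pI]] := main (enum (~: T)); first exact: enum_uniq.
  by rewrite mem_enum inE.
exists p => //; rewrite ZE => f If; apply: pI; last first.
  by move=> z; rewrite ZE; apply.
apply: polyin_subset (polyfun_polyin XE (Ip _ If)).
by apply/fintype.subsetP => i _; rewrite !inE mem_enum inE orbN.
Qed.

End Fibers.

Lemma sum_enum_ord (k : fieldType) (V : lmodType k) c (I : finType) (A : {set I})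
    (e : I -> V) (a : I -> k) : (#|A| <= c)%N -> forall i0 : I,
  \sum_(i in A) a i *: e i =
  \sum_(l < c) (if (l < #|A|)%N then a (nth i0 (enum A) l) else 0) *: e (nth i0 (enum A) l).
Proof.
move=> Ac i0; rewrite -big_enum (big_nth i0) big_mkord -cardE.
rewrite (big_ord_widen _ (fun l => a (nth i0 (enum A) l) *: e (nth i0 (enum A) l)) Ac).
rewrite [RHS](bigID (fun l : 'I_c => l < #|A|)%N) /= [X in _ = _ + X]big1 ?addr0.
  by apply: eq_bigr => l ->.
by move=> l /negbTE ->; rewrite scale0r.
Qed.

(** The vectors are a common translation t0, which makes all the points generic,
    and the basis vectors of the coordinates outside an independent set. *)
Lemma findim_translates (k : closedFieldType) (V : lmodType k) c (X2 : set V) :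
    findim_codim_le c X2 ->
  forall (J : finType) (t : J -> V), exists eta : 'I_c.+1 -> V,
    forall j, exists y : 'I_c.+1 -> k, X2 (t j + \sum_i y i *: eta i).
Proof.
move=> [N [m [/findim_coordinates[e [X [XE Xe]]] [[Z [ZP Zlt]] _] Nmc]]] J t.
have [|//|T0 indT0 mT0] := @chain_indep _ _ _ e X XE Z m.
  by move=> i /ZP[].
have [algZ irrZ ZX] := ZP m (leqnn m).
have [T [indT T0T Tmax]] := indep_max indT0.
have [g [pf_g g0 gP]] := generic_fiber XE Xe algZ indT Tmax.
(* t0 moves all the points into the open set over which Z has points *)
have [t0 t0P] : exists t0, forall P : pred ('I_N * J),
    \prod_(ij | P ij) g ij.1 (t ij.2 + t0) != 0.
  apply: (@polyfun_prod_neq0 _ _ _ _ (fun (ij : 'I_N * J) v => g ij.1 (t ij.2 + v))) => ij.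
    elim: (pf_g ij.1) => [a|f|f1 f2 _ p1 _ p2|f1 f2 _ p1 _ p2].
    - exact: polyfun_cst.
    - have -> : (fun v => f (t ij.2 + v)) = (fun v => (fun=> f (t ij.2)) v + f v).
        by apply/funext => v; rewrite linearD.
      by apply: polyfun_add; [exact: polyfun_cst|exact: polyfun_linear].
    - exact: polyfun_add.
    - exact: polyfun_mul.
  by have [v gv] := g0 ij.1; exists (v - t ij.2); rewrite addrC subrK.
have cT : (#|~: T| <= c)%N.
  by rewrite cardsCs finset.setCK card_ord leq_subLR (leq_trans Nmc) // leq_add2r (leq_trans mT0).
have zP j : exists2 z, Z m z & forall i, i \in T -> X i z = X i (t j + t0).
  apply: gP => i; have := t0P (pred1 (i, j)).
  by rewrite big_pred1_eq.
have [N0|[i0]] : (N = 0)%N \/ inhabited 'I_N.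
- by case: (N) => [|N']; [left|right; exact: (inhabits ord0)].
- have V0 (v w : V) : v = w.
    rewrite (XE v) (XE w); move: N0 (e) (X) => -> e' X'; by rewrite !big_ord0.
  exists (fun=> 0) => j; exists (fun=> 0); have [z Zz _] := zP j.
  by rewrite (V0 (_ + _) z); exact: ZX.
pose b (l : 'I_c) := e (nth i0 (enum (~: T)) l).
exists (fun i => if unlift ord0 i is Some l then b l else t0) => j.
have [z Zz zT] := zP j.
pose a i := X i (z - (t j + t0)).
exists (fun i => if unlift ord0 i is Some l then
   if (l < #|~: T|)%N then a (nth i0 (enum (~: T)) l) else 0 else 1).
rewrite big_ord_recl unlift_none scale1r addrA.
under eq_bigr do rewrite liftK.
rewrite -(sum_enum_ord e a cT).
suff -> : \sum_(i in ~: T) a i *: e i = z - (t j + t0) by rewrite addrC subrK; exact: ZX.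
rewrite [RHS]XE [RHS](bigID (fun i => i \in T)) /= [X in _ = X + _]big1 ?add0r.
  by apply: eq_bigl => i; rewrite inE.
by move=> i /zT iT; rewrite linearB /= iT subrr scale0r.
Qed.

Lemma codim_translates (k : closedFieldType) (V : lmodType k) c (S : set V) :
    codim_le c S ->
  forall (J : finType) (t : J -> V), exists eta : 'I_c.+1 -> V,
    forall j, exists y : 'I_c.+1 -> k, S (t j + \sum_i y i *: eta i).
Proof.
move=> [V1 [V2 [[Vsum _] _ [X2 [_ codX2 X2S]]]]] J t.
have /choice[v vP] : forall j, exists v : V * subsp V2, v.1 \in V1 /\ t j = v.1 + val v.2.
  by move=> j; have [v1 [v2 [v1V v2V ->]]] := Vsum (t j); exists (v1, Subsp v2V).
have [eta etaP] := findim_translates codX2 (fun j => (v j).2).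
exists (fun i => val (eta i)) => j; have [y yP] := etaP j; exists y.
have [v1V ->] := vP j.
rewrite -addrA; have := X2S _ _ v1V yP.
rewrite raddfD raddf_sum.
suff -> : \sum_i y i *: val (eta i) = \sum_i val (y i *: eta i) by [].
by apply: eq_bigr => i _; rewrite GRing.valZ.
Qed.

(** * Lie brackets and words in adjoint operators *)

Section LieBasics.
Variables (k : fieldType) (L : lieAlgType k).
Implicit Types x y z : L.

Lemma lieDl x x' y : [Lie x + x', y] = [Lie x, y] + [Lie x', y].
Proof. by rewrite -[x in LHS]scale1r lie_linearl scale1r. Qed.
Lemma lieDr x y y' : [Lie x, y + y'] = [Lie x, y] + [Lie x, y'].
Proof. by rewrite -[y in LHS]scale1r lie_linearr scale1r. Qed.
Lemma lie0l y : [Lie (0 : L), y] = 0.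
Proof. by apply: (addrI [Lie 0, y]); rewrite -lieDl !addr0. Qed.
Lemma lie0r x : [Lie x, (0 : L)] = 0.
Proof. by apply: (addrI [Lie x, 0]); rewrite -lieDr !addr0. Qed.
Lemma lieZl a x y : [Lie a *: x, y] = a *: [Lie x, y].
Proof. by rewrite -[a *: x]addr0 lie_linearl lie0l addr0. Qed.
Lemma lieZr a x y : [Lie x, a *: y] = a *: [Lie x, y].
Proof. by rewrite -[a *: y]addr0 lie_linearr lie0r addr0. Qed.
Lemma lieNr x y : [Lie x, - y] = - [Lie x, y].
Proof. by rewrite -scaleN1r lieZr scaleN1r. Qed.

Lemma lieC x y : [Lie x, y] = - [Lie y, x].
Proof.
apply/eqP; rewrite -addr_eq0; have := liexx (x + y).
by rewrite lieDl !lieDr !liexx addr0 add0r => ->.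
Qed.

Lemma lie_suml I (r : seq I) (P : pred I) (F : I -> L) y :
  [Lie \sum_(i <- r | P i) F i, y] = \sum_(i <- r | P i) [Lie F i, y].
Proof.
exact: (big_morph (fun x => [Lie x, y]) (fun x x' => lieDl x x' y) (lie0l y)).
Qed.

Lemma lie_sumr I (r : seq I) (P : pred I) (F : I -> L) x :
  [Lie x, \sum_(i <- r | P i) F i] = \sum_(i <- r | P i) [Lie x, F i].
Proof. exact: (big_morph _ (lieDr x) (lie0r x)). Qed.

Lemma lie_brA x y z : [Lie [Lie x, y], z] = [Lie x, [Lie y, z]] - [Lie y, [Lie x, z]].
Proof.
rewrite lieC; apply/eqP; rewrite eq_sym -addr_eq0 -(lie_jacobi x y z).
by rewrite [[Lie z, x]]lieC lieNr.
Qed.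

End LieBasics.

Section Words.

Lemma sum_words_cons (A : finType) (V : nmodType) l (F : seq A -> V) :
  \sum_(w : l.+1.-tuple A) F w = \sum_a \sum_(w : l.-tuple A) F (a :: w).
Proof.
rewrite pair_big (reindex (fun p : A * l.-tuple A => [tuple of p.1 :: p.2])) //=.
exists (fun w : l.+1.-tuple A => (thead w, [tuple of behead w])) => [[a w] _|w _] /=.
  by congr pair; apply: val_inj.
by rewrite -tuple_eta.
Qed.

Lemma sum_words_nil (A : finType) (V : nmodType) (F : seq A -> V) :
  \sum_(w : 0.-tuple A) F w = F [::].
Proof.
rewrite (bigD1 [tuple]) //= big1 ?addr0 // => w /eqP[].
by rewrite tuple0.
Qed.

Lemma sum_words_cat (A : finType) (V : nmodType) m a b (F : seq A -> V) : m = (a + b)%N ->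
  \sum_(w : m.-tuple A) F w = \sum_(s : a.-tuple A) \sum_(t : b.-tuple A) F (s ++ t).
Proof.
move=> ->; elim: a F => [|a IHa] F.
  by rewrite (@sum_words_nil _ _ (fun s => \sum_(t : b.-tuple A) F (s ++ t))).
rewrite addSn sum_words_cons (@sum_words_cons _ _ _ (fun s => \sum_(t : b.-tuple A) F (s ++ t))).
by apply: eq_bigr => x _; rewrite (IHa (fun s => F (x :: s))).
Qed.

Variables (k : fieldType) (L : lieAlgType k).

Definition ad_word (A : Type) (r : A -> L) (s : seq A) (y : L) :=
  foldr (fun a z => [Lie r a, z]) y s.

Lemma ad_word_cat A (r : A -> L) s t y : ad_word r (s ++ t) y = ad_word r s (ad_word r t y).
Proof. exact: foldr_cat. Qed.

Lemma ad_word_linear A (r : A -> L) s : linear (ad_word r s).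
Proof. by move=> a x y; elim: s => //= b s ->; rewrite lie_linearr. Qed.

HB.instance Definition _ A (r : A -> L) s :=
  GRing.isLinear.Build k L L *:%R (ad_word r s) (ad_word_linear r s).

Lemma eq_ad_word A (r r' : A -> L) s y : r =1 r' -> ad_word r s y = ad_word r' s y.
Proof. by move=> rr'; elim: s => //= b s ->; rewrite rr'. Qed.

End Words.

(** The coefficients q are those of the image of P in the free associative
    algebra.  They depend on P only, so the same q serves all Lie algebras. *)
Lemma lie_homog_words (k : fieldType) n a (P : freeLie k n) : lie_homog a P ->
  exists q : seq 'I_n -> k, forall (L : lieAlgType k) (r : 'I_n -> L) y,
    [Lie lie_eval r P, y] = \sum_(w : a.-tuple 'I_n) q w *: ad_word r w y.
Proof.
elim=> [i|{}a b {}P Q _ [p IHP] _ [q IHQ]|{}a|{}a c {}P Q _ [p IHP] _ [q IHQ]].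
- exists (fun w => (w == [:: i])%:R) => L r y.
  rewrite lie_eval_var (@sum_words_cons _ _ _ (fun w => (w == [:: i])%:R *: ad_word r w y)).
  under eq_bigr do rewrite (@sum_words_nil _ _ (fun w => ((_ :: w) == [:: i])%:R *: ad_word r (_ :: w) y)).
  rewrite (bigD1 i) //= eqxx scale1r big1 ?addr0 // => j ji.
  by rewrite eqseq_cons (negbTE ji) scale0r.
- exists (fun w => p (take a w) * q (drop a w) - q (take b w) * p (drop b w)) => L r y.
  rewrite lie_eval_br lie_brA.
  under eq_bigr do rewrite scalerBl.
  rewrite sumrB; congr (_ - _).
    rewrite (@sum_words_cat _ _ _ a b (fun w => (p (take a w) * q (drop a w)) *: ad_word r w y)) //.
    rewrite IHQ IHP; apply: eq_bigr => s _; rewrite linear_sum scaler_sumr.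
    apply: eq_bigr => t _.
    by rewrite take_size_cat ?drop_size_cat ?size_tuple // linearZ scalerA ad_word_cat.
  rewrite (@sum_words_cat _ _ _ b a (fun w => (q (take b w) * p (drop b w)) *: ad_word r w y)) 1?addnC //.
  rewrite IHP IHQ; apply: eq_bigr => s _; rewrite linear_sum scaler_sumr.
  apply: eq_bigr => t _.
  by rewrite take_size_cat ?drop_size_cat ?size_tuple // linearZ scalerA ad_word_cat.
- exists (fun=> 0) => L r y; rewrite linear0 lie0l big1 // => w _; exact: scale0r.
- exists (fun w => c * p w + q w) => L r y.
  rewrite linearP lie_linearl IHP IHQ scaler_sumr -big_split; apply: eq_bigr => w _.
  by rewrite scalerDl scalerA.
Qed.

(** * A Lie algebra of sequences with the shift derivation *)

Section Current.
Variables (k : fieldType) (L : lieAlgType k).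
Implicit Types f g h : nat -> L.

Definition shift f : nat -> L := fun i => f i.+1.

(** The bracket of sequences determined by [f, g](0) = [f(0), g(0)] and by the
    requirement that the shift be a derivation.  In closed form it is the
    divided power convolution sum_j binom(a, j) [f(j), g(a - j)]; the recursion
    avoids binomials and reduces every identity to the Lie algebra L by
    induction on a. *)
Fixpoint seq_br_at a f g : L :=
  if a is a'.+1 then seq_br_at a' (shift f) g + seq_br_at a' f (shift g) else [Lie f 0%N, g 0%N].

Definition seq_br f g : nat -> L := fun a => seq_br_at a f g.

Lemma seq_br_linl a c f f' g : seq_br_at a (c *: f + f') g = c *: seq_br_at a f g + seq_br_at a f' g.
Proof.
elim: a f f' g => [|a IHa] f f' g /=; first exact: lie_linearl.
by rewrite -[shift _]/(c *: shift f + shift f') !IHa scalerDr addrACA.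
Qed.

Lemma seq_brC a f g : seq_br_at a f g = - seq_br_at a g f.
Proof.
elim: a f g => [|a IHa] f g /=; first exact: lieC.
by rewrite opprD IHa [seq_br_at a f (shift g)]IHa addrC.
Qed.

Lemma seq_br_linr a c f g g' : seq_br_at a f (c *: g + g') = c *: seq_br_at a f g + seq_br_at a f g'.
Proof. by rewrite seq_brC seq_br_linl opprD -scalerN -!seq_brC. Qed.

Lemma seq_brxx a f : seq_br_at a f f = 0.
Proof.
case: a => [|a] /=.
  exact: liexx.
by rewrite seq_brC addNr.
Qed.

Lemma seq_brDr a f g g' : seq_br_at a f (g + g') = seq_br_at a f g + seq_br_at a f g'.
Proof. by rewrite -{1}[g]scale1r seq_br_linr scale1r. Qed.

Lemma seq_brZr a c f g : seq_br_at a f (c *: g) = c *: seq_br_at a f g.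
Proof. by apply: (addIr (seq_br_at a f g)); rewrite -seq_br_linr seq_brDr. Qed.

Lemma seq_br0l a g : seq_br_at a 0 g = 0.
Proof. by rewrite seq_brC -(scale0r (0 : nat -> L)) seq_brZr scale0r oppr0. Qed.

Lemma seq_br_jacobi a f g h :
  seq_br_at a f (seq_br g h) + seq_br_at a g (seq_br h f) + seq_br_at a h (seq_br f g) = 0.
Proof.
elim: a f g h => [|a IHa] f g h /=; first exact: lie_jacobi.
have sE u v : shift (seq_br u v) = seq_br (shift u) v + seq_br u (shift v) by [].
rewrite !sE !seq_brDr.
rewrite !addrA (ACl ((1*6*8)*(2*4*9)*(3*5*7))%AC) /=.
by rewrite !IHa !addr0.
Qed.

(** The semidirect product of the sequences by the line spanned by the shift. *)
Definition current : Type := (k * (nat -> L))%type.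

HB.instance Definition _ := GRing.Lmodule.copy current (k^o * (nat -> L))%type.

Definition cbr (u v : current) : current :=
  (0, (u.1 : k) *: shift v.2 - (v.1 : k) *: shift u.2 + seq_br u.2 v.2).

Fact cbr_linl v (a : k) u u' : cbr (a *: u + u') v = a *: cbr u v + cbr u' v.
Proof.
case: u u' v => [x f] [x' f'] [y g]; congr pair; first by rewrite /= scaler0 addr0.
apply/funext => i; rewrite /cbr /=.
rewrite -[LHS]/((a * x + x') *: g i.+1 - y *: (a *: f i.+1 + f' i.+1) + seq_br_at i (a *: f + f') g).
rewrite -[RHS]/(a *: (x *: g i.+1 - y *: f i.+1 + seq_br_at i f g) + (x' *: g i.+1 - y *: f' i.+1 + seq_br_at i f' g)).
rewrite seq_br_linl scalerDl !scalerDr scalerN !scalerA [y * a]mulrC opprD !addrA.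
by rewrite (ACl (1*3*5*2*4*6)%AC).
Qed.

Fact cbrC u v : cbr u v = - cbr v u.
Proof.
case: u v => [x f] [y g]; congr pair; first by rewrite /= oppr0.
apply/funext => i; rewrite -[LHS]/(x *: g i.+1 - y *: f i.+1 + seq_br_at i f g).
rewrite -[RHS]/(- (y *: f i.+1 - x *: g i.+1 + seq_br_at i g f)).
by rewrite opprD opprB -seq_brC.
Qed.

Fact cbr_linr u (a : k) v v' : cbr u (a *: v + v') = a *: cbr u v + cbr u v'.
Proof. by rewrite cbrC cbr_linl opprD -scalerN -!cbrC. Qed.

Fact cbrxx u : cbr u u = 0.
Proof.
case: u => x f; congr pair; apply/funext => i.
by rewrite -[LHS]/(x *: f i.+1 - x *: f i.+1 + seq_br_at i f f) seq_brxx subrr addr0.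
Qed.

(** The terms without a bracket of two sequences cancel since scalars commute,
    those with one shift since the shift is a derivation. *)
Fact cbr_jacobi u v w : cbr u (cbr v w) + cbr v (cbr w u) + cbr w (cbr u v) = 0.
Proof.
case: u v w => [x f] [y g] [z h]; congr pair; first by rewrite /= !addr0.
apply/funext => i.
pose T x f y g z h : L := x *: (y *: h i.+2 - z *: g i.+2 + (seq_br_at i (shift g) h + seq_br_at i g (shift h)))
   - 0 *: f i.+1 + seq_br_at i f (y *: shift h - z *: shift g + seq_br g h).
rewrite -[LHS]/(T x f y g z h + T y g z h x f + T z h x f y g).
have TE x' f' y' g' z' h' : T x' f' y' g' z' h' =
  x' *: (y' *: h' i.+2) - x' *: (z' *: g' i.+2) + x' *: seq_br_at i (shift g') h'
  + x' *: seq_br_at i g' (shift h') + y' *: seq_br_at i f' (shift h') - z' *: seq_br_at i f' (shift g')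
  + seq_br_at i f' (seq_br g' h').
  rewrite /T scale0r subr0 -[- (z' *: shift g')]scaleNr !seq_brDr !seq_brZr scaleNr.
  by rewrite !scalerDr scalerN !addrA.
rewrite !TE (seq_brC i h (seq_br f g)) (seq_brC i h (shift f)) (seq_brC i h (shift g)) (seq_brC i g (shift f)).
rewrite (seq_brC i (shift h) f) -(seq_brC i h (seq_br f g)) !scalerN !opprK !addrA.
rewrite [y *: (x *: _)]scalerA [y * x]mulrC -[(x * y) *: _]scalerA.
rewrite [x *: (z *: _)]scalerA [x * z]mulrC -[(z * x) *: _]scalerA.
rewrite [y *: (z *: _)]scalerA [y * z]mulrC -[(z * y) *: _]scalerA.
rewrite (ACl ((1*9)*(2*15)*(3*19)*(4*13)*(5*10)*(6*18)*(8*16)*(11*20)*(12*17)*(7*14*21))%AC) /=.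
by rewrite !(subrr, addNr) !add0r; apply: seq_br_jacobi.
Qed.

HB.instance Definition _ := Lmodule_isLieAlgebra.Build k current
  cbr_linl cbr_linr cbrxx cbr_jacobi.

End Current.

(** * Faithfulness of word expansions by elimination *)

Section Filtration.
Variable k : fieldType.

(** The elements of degree at most a in generators taken from U.  Degree 0
    contains only zero, so that a degree bound can be lowered by one. *)
Inductive lie_le (L : lieAlgType k) (U : L -> Prop) : nat -> L -> Prop :=
  | le_gen u : U u -> lie_le U 1 u
  | le_br a b P Q : lie_le U a P -> lie_le U b Q -> lie_le U (a + b) [Lie P, Q]
  | le_zero a : lie_le U a 0
  | le_lin a (c : k) P Q : lie_le U a P -> lie_le U a Q -> lie_le U a (c *: P + Q)
  | le_mono a b P : (a <= b)%N -> lie_le U a P -> lie_le U b P.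

Section Closure.
Variables (L : lieAlgType k) (U : L -> Prop).

Lemma lie_leD a P Q : lie_le U a P -> lie_le U a Q -> lie_le U a (P + Q).
Proof. by move=> leP leQ; rewrite -[P]scale1r; exact: le_lin. Qed.

Lemma lie_leZ a (c : k) P : lie_le U a P -> lie_le U a (c *: P).
Proof. by move=> leP; rewrite -[_ *: P]addr0; apply: le_lin leP (le_zero U a). Qed.

Lemma lie_leN a P : lie_le U a P -> lie_le U a (- P).
Proof. by rewrite -scaleN1r; apply: lie_leZ. Qed.

Lemma lie_le0 P : lie_le U 0 P -> P = 0.
Proof.
suff H a : lie_le U a P -> a = 0%N -> P = 0 by move/H; apply.
elim=> // {P}.
- by move=> {}a b P Q _ IHP _ _ /eqP; rewrite addn_eq0 => /andP[/eqP/IHP-> _]; rewrite lie0l.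
- by move=> {}a c P Q _ IHP _ IHQ a0; rewrite IHP // IHQ // scaler0 addr0.
- by move=> {}a b P ab _ IHP b0; apply: IHP; apply/eqP; rewrite -leqn0 -b0.
Qed.

End Closure.

Definition is_var n (Q : freeLie k n) := exists i, Q = free_var k i.

Lemma lie_homog_le n a (Q : freeLie k n) : lie_homog a Q -> lie_le (@is_var n) a Q.
Proof.
elim=> [i|{}a b {}P {}Q _ IHP _ IHQ|{}a|{}a c {}P {}Q _ IHP _ IHQ].
- by apply: le_gen; exists i.
- exact: le_br.
- exact: le_zero.
- exact: le_lin.
Qed.

Lemma eq_lie_eval n (L : lieAlgType k) (r s : 'I_n -> L) : r =1 s -> lie_eval r =1 lie_eval s.
Proof. by move=> /funext ->. Qed.

Lemma lie_eval_comp n m (L : lieAlgType k) (s : 'I_m -> L) (R : 'I_n -> freeLie k m) Q :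
  lie_eval s (lie_eval R Q) = lie_eval (fun i => lie_eval s (R i)) Q.
Proof.
pose f : {linear freeLie k n -> L} := lie_eval s \o lie_eval R.
rewrite -[LHS]/(f Q); apply: lie_eval_unique => [P Q'|i] /=.
  by rewrite !lie_eval_br.
by rewrite lie_eval_var.
Qed.

Lemma lie_le_eval n (L : lieAlgType k) (U : L -> Prop) (r : 'I_n -> L) a Q :
  (forall i, lie_le U 1 (r i)) -> lie_le (@is_var n) a Q -> lie_le U a (lie_eval r Q).
Proof.
move=> Ur; elim=> [_ [i ->]|{}a b {}P {}Q _ IHP _ IHQ|{}a|{}a c {}P {}Q _ IHP _ IHQ|{}a b P ab _ IHP].
- by rewrite lie_eval_var.
- by rewrite lie_eval_br; exact: le_br.
- by rewrite linear0; exact: le_zero.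
- by rewrite linearP; exact: le_lin.
- exact: le_mono ab IHP.
Qed.

Section Elimination.
Variable n : nat.

Let x : freeLie k n.+1 := free_var k ord0.

Definition kill0 : freeLie k n.+1 -> freeLie k n :=
  lie_eval (fun i => if unlift ord0 i is Some j then free_var k j else 0).

Definition raise : freeLie k n -> freeLie k n.+1 :=
  lie_eval (fun j => free_var k (lift ord0 j)).

Definition iter_ad (e : nat) (j : 'I_n) : freeLie k n.+1 :=
  iter e (lie_bracket x) (free_var k (lift ord0 j)).

Definition is_iter_ad (u : freeLie k n.+1) := exists e j, u = iter_ad e j.

Lemma ad0_le b S : lie_le is_iter_ad b S -> lie_le is_iter_ad b [Lie x, S].
Proof.
elim=> [_ [e [j ->]]|{}a {}b P Q leP IHP leQ IHQ|{}b|{}b c P Q _ IHP _ IHQ|{}a {}b P ab _ IHP].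
- by apply: le_gen; exists e.+1, j.
- have -> : [Lie x, [Lie P, Q]] = [Lie [Lie x, P], Q] + [Lie P, [Lie x, Q]].
    by rewrite lie_brA subrK.
  by apply: lie_leD; apply: le_br.
- by rewrite lie0r; exact: le_zero.
- by rewrite lie_linearr; exact: le_lin.
- exact: le_mono ab IHP.
Qed.

Lemma raise_le a R : lie_le (@is_var n) a R -> lie_le is_iter_ad a (raise R).
Proof. by apply: lie_le_eval => j; apply: le_gen; exists 0%N, j. Qed.

Lemma kill0_le a Q : lie_le (@is_var n.+1) a Q -> lie_le (@is_var n) a (kill0 Q).
Proof.
apply: lie_le_eval => i; case: unliftP => [j _|_]; last exact: le_zero.
by apply: le_gen; exists j.
Qed.

(** A commutator that involves the variable x = x_0 can be rewritten with fewer
    factors, since [x, _] preserves degree in the letters ad(x)^e(x_i). *)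
Lemma elimination_split a Q : lie_le (@is_var n.+1) a Q ->
  exists (c : k) S, lie_le is_iter_ad a.-1 S /\ Q = raise (kill0 Q) + c *: x + S.
Proof.
elim=> [_ [i ->]|{}a b P {}Q leP [c [S [leS PE]]] leQ [c' [S' [leS' QE]]]|{}a|
        {}a c P {}Q leP [c1 [S [leS PE]]] leQ [c2 [S' [leS' QE]]]|{}a b P ab leP [c [S [leS PE]]]].
- rewrite /kill0 lie_eval_var; case: unliftP => [j ->|->].
    exists 0, 0; split; first exact: le_zero.
    by rewrite /raise lie_eval_var scale0r !addr0.
  exists 1, 0; split; first exact: le_zero.
  by rewrite /raise linear0 add0r scale1r addr0.
- have [a0|a0] := posnP a.
    rewrite a0 in leP; exists 0, 0; split; first exact: le_zero.
    by rewrite (lie_le0 leP) lie0l /kill0 /raise !linear0 scale0r !addr0.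
  have [b0|b0] := posnP b.
    rewrite b0 in leQ; exists 0, 0; split; first exact: le_zero.
    by rewrite (lie_le0 leQ) lie0r /kill0 /raise !linear0 scale0r !addr0.
  pose P0 := raise (kill0 P); pose Q0 := raise (kill0 Q).
  have leP0 : lie_le is_iter_ad a P0 by apply/raise_le/kill0_le.
  have leQ0 : lie_le is_iter_ad b Q0 by apply/raise_le/kill0_le.
  exists 0, ([Lie P0, c' *: x + S'] + [Lie c *: x + S, Q]); split; last first.
    have -> : raise (kill0 [Lie P, Q]) = [Lie P0, Q0] by rewrite /kill0 /raise !lie_eval_br.
    rewrite -/P0 in PE; rewrite -/Q0 in QE.
    by rewrite scale0r addr0 addrA -lieDr addrA -QE -lieDl addrA -PE.
  have mono d R : (d <= (a + b).-1)%N -> lie_le is_iter_ad d R ->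
      lie_le is_iter_ad (a + b).-1 R by exact: le_mono.
  have ad_r R : [Lie R, x] = - [Lie x, R] by exact: lieC.
  have a_le : (a <= (a + b).-1)%N.
    by rewrite -ltnS prednK ?addn_gt0 ?a0 // -[X in (X < _)%N]addn0 ltn_add2l.
  have b_le : (b <= (a + b).-1)%N.
    by rewrite -ltnS prednK ?addn_gt0 ?a0 // -[X in (X < _)%N]add0n ltn_add2r.
  have a1_le : (a.-1 <= (a + b).-1)%N by apply: leq_trans (leq_pred _) a_le.
  have b1_le : (b.-1 <= (a + b).-1)%N by apply: leq_trans (leq_pred _) b_le.
  rewrite QE -/Q0 !lieDr !lieDl !lieZl !lieZr liexx !scaler0 add0r.
  do ?apply: lie_leD.
  - by apply/lie_leZ/(mono a) => //; rewrite ad_r; apply/lie_leN/ad0_le.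
  - by apply: mono (le_br leP0 leS'); rewrite -!subn1 addnBA.
  - by apply/lie_leZ/(mono b)/ad0_le.
  - by apply: mono (le_br leS leQ0); rewrite -!subn1 addnBAC.
  - by apply/lie_leZ/(mono a.-1) => //; rewrite ad_r; apply/lie_leN/ad0_le.
  - by apply/lie_leZ/(mono b.-1)/ad0_le.
  - apply: mono (le_br leS leS'); rewrite -!subn1 addnBA // leq_sub2r //.
    by rewrite leq_add2r leq_subr.
- exists 0, 0; split; first exact: le_zero.
  by rewrite /kill0 /raise !linear0 scale0r !addr0.
- exists (c * c1 + c2), (c *: S + S'); split; first exact: le_lin.
  rewrite /kill0 /raise !linearP -/kill0 -/raise {1}PE {1}QE !scalerDr !scalerDl !scalerA.
  by rewrite !addrA (ACl (1*4*2*5*3*6)%AC).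
- exists c, S; split=> //; apply: le_mono leS.
  by rewrite -!subn1 leq_sub2r.
Qed.

Definition from_iter_ad N : freeLie k #|{: 'I_n * 'I_N}| -> freeLie k n.+1 :=
  lie_eval (fun y => let p : 'I_n * 'I_N := enum_val y in iter_ad p.2 p.1).

Lemma from_iter_ad_widen N N' a Q : (N <= N')%N -> lie_le (@is_var _) a Q ->
  exists2 Q', lie_le (@is_var _) a Q' & @from_iter_ad N' Q' = @from_iter_ad N Q.
Proof.
move=> NN' leQ.
pose w (y : 'I_#|{: 'I_n * 'I_N}|) : 'I_#|{: 'I_n * 'I_N'}| :=
  enum_rank ((enum_val y).1, widen_ord NN' (enum_val y).2).
exists (lie_eval (fun y => free_var k (w y)) Q).
  by apply: lie_le_eval leQ => y; apply: le_gen; exists (w y).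
rewrite /from_iter_ad lie_eval_comp; apply: eq_lie_eval => y.
by rewrite lie_eval_var enum_rankK.
Qed.

Lemma from_iter_ad_onto b S : lie_le is_iter_ad b S ->
  exists N Q, lie_le (@is_var _) b Q /\ @from_iter_ad N Q = S.
Proof.
elim=> [_ [e [j ->]]|{}a {}b P Q _ [N1 [P' [leP PE]]] _ [N2 [Q' [leQ QE]]]|{}b|
   {}b c P Q _ [N1 [P' [leP PE]]] _ [N2 [Q' [leQ QE]]]|{}a {}b P ab _ [N [P' [leP PE]]]].
- exists e.+1, (free_var k (enum_rank (j, ord_max))); split.
    by apply: le_gen; eexists.
  by rewrite /from_iter_ad lie_eval_var enum_rankK.
- have [P'' leP'' PE'] := from_iter_ad_widen (leq_maxl N1 N2) leP.
  have [Q'' leQ'' QE'] := from_iter_ad_widen (leq_maxr N1 N2) leQ.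
  exists (maxn N1 N2), [Lie P'', Q'']; split; first exact: le_br.
  by rewrite /from_iter_ad lie_eval_br -[lie_eval _ P'']/(from_iter_ad P'') -[lie_eval _ Q'']/(from_iter_ad Q'') PE' QE' PE QE.
- by exists 0%N, 0; split; [exact: le_zero|rewrite /from_iter_ad linear0].
- have [P'' leP'' PE'] := from_iter_ad_widen (leq_maxl N1 N2) leP.
  have [Q'' leQ'' QE'] := from_iter_ad_widen (leq_maxr N1 N2) leQ.
  exists (maxn N1 N2), (c *: P'' + Q''); split; first exact: le_lin.
  by rewrite /from_iter_ad linearP /= -[lie_eval _ P'']/(from_iter_ad P'') -[lie_eval _ Q'']/(from_iter_ad Q'') PE' QE' PE QE.
- by exists N, P'; split=> //; exact: le_mono leP.
Qed.

End Elimination.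

(** The failure of ad(Q) to vanish identically; by [lie_homog_words] it implies
    that some word coefficient of Q is not zero. *)
Definition detected n (Q : freeLie k n) :=
  exists (L : lieAlgType k) (r : 'I_n -> L) (m : L), [Lie lie_eval r Q, m] <> 0.

Lemma lie_eval_current n (L : lieAlgType k) (u : 'I_n -> nat -> L) (Q : freeLie k n) :
  let v := lie_eval (fun y => (0, u y) : current L) Q in
  v.1 = 0 /\ v.2 0%N = lie_eval (fun y => u y 0%N) Q.
Proof.
elim/quotW: Q => t; rewrite !lie_eval_pi.
elim: t => [i||s [s1 s2] t [t1 t2]|s [s1 s2]|a s [s1 s2]|s [s1 s2] t [t1 t2]] //=.
- by rewrite s1 t1 addr0; split=> //; rewrite -s2 -t2.
- by rewrite s1 oppr0; split=> //; rewrite -s2.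
- by rewrite s1 scaler0; split=> //; rewrite -s2.
- split=> //; rewrite -s2 -t2 -[LHS]/(_ *: _ - _ *: _ + [Lie _, _]) s1 t1.
  by rewrite !scale0r subrr add0r.
Qed.

Section DetectStep.
Variables (L : lieAlgType k) (n N : nat) (r : 'I_#|{: 'I_n * 'I_N}| -> L).

(** With x_0 acting as the shift and x_j as the sequence of the values that the
    letters ad(x_0)^e(x_j) should take, these letters, for e < N, evaluate at
    index 0 to the prescribed r. *)
Definition current_assign (i : 'I_n.+1) : current L :=
  if unlift ord0 i is Some j then
    (0, fun e => if insub e is Some e' then r (enum_rank (j, e')) else 0)
  else (1, fun=> 0).

Lemma current_assign_iter_ad e j :
  lie_eval current_assign (iter_ad e j) = (0, iter e (@shift k L) (current_assign (lift ord0 j)).2).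
Proof.
elim: e => [|e IHe]; first by rewrite lie_eval_var /current_assign liftK.
rewrite /= lie_eval_br IHe lie_eval_var /current_assign unlift_none.
congr pair; apply/funext => i.
rewrite -[LHS]/(1 *: _ - 0 *: _ + seq_br_at _ 0 _) scale1r scale0r subr0.
by rewrite seq_br0l addr0.
Qed.

Lemma from_iter_ad_current (Q : freeLie k #|{: 'I_n * 'I_N}|) :
  exists2 f, lie_eval current_assign (from_iter_ad Q) = (0, f) & f 0%N = lie_eval r Q.
Proof.
have shiftE e f i : iter e (@shift k L) f i = f (e + i)%N.
  by elim: e i => // e IHe i; rewrite iterS /shift IHe addnS.
pose u (y : 'I_#|{: 'I_n * 'I_N}|) := let p : 'I_n * 'I_N := enum_val y in
  iter p.2 (@shift k L) (current_assign (lift ord0 p.1)).2.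
rewrite /from_iter_ad lie_eval_comp.
rewrite (eq_lie_eval (s := fun y => (0, u y) : current L)); last first.
  by move=> y; rewrite /= current_assign_iter_ad.
have [] := lie_eval_current u Q; case: (lie_eval _ Q) => a f /= -> f0.
exists f => //; rewrite f0; apply: eq_lie_eval => y.
rewrite /u shiftE addn0 /current_assign liftK /= insubT //= => lt.
by rewrite -[RHS]/(r y) -[y in RHS]enum_valK; congr (r (enum_rank _)); case: (enum_val y) lt => j e lt; congr pair; apply: val_inj.
Qed.

End DetectStep.

Section LineAlgebra.

(** The base case: sequences over the trivial Lie algebra k, where only the shift
    acts, detect the multiples of x_0. *)
Definition abelian_line : Type := k^o.
HB.instance Definition _ := GRing.Lmodule.copy abelian_line k^o.
Definition abelian_bracket (x y : abelian_line) : abelian_line := 0.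

Fact abelian_linl y (a : k) x x' :
  abelian_bracket (a *: x + x') y = a *: abelian_bracket x y + abelian_bracket x' y.
Proof. by rewrite /abelian_bracket scaler0 addr0. Qed.
Fact abelian_linr x (a : k) y y' :
  abelian_bracket x (a *: y + y') = a *: abelian_bracket x y + abelian_bracket x y'.
Proof. by rewrite /abelian_bracket scaler0 addr0. Qed.
Fact abelian_xx x : abelian_bracket x x = 0. Proof. by []. Qed.
Fact abelian_jacobi x y z :
  abelian_bracket x (abelian_bracket y z) + abelian_bracket y (abelian_bracket z x)
    + abelian_bracket z (abelian_bracket x y) = 0.
Proof. by rewrite /abelian_bracket !addr0. Qed.

HB.instance Definition _ := Lmodule_isLieAlgebra.Build k abelian_line
  abelian_linl abelian_linr abelian_xx abelian_jacobi.

End LineAlgebra.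

Lemma cbr_derivation (L : lieAlgType k) (c : k) (g : nat -> L) :
  [Lie ((c, fun=> 0) : current L), ((0, g) : current L)] = (0, c *: shift g).
Proof.
congr pair; apply/funext => i; rewrite -[LHS]/(c *: _ - 0 *: _ + seq_br_at _ 0 _).
by rewrite seq_br0l addr0 scale0r subr0.
Qed.

(** Induction on the degree bound and, inside it, on the number of variables.
    If Q does not vanish for x_0 = 0, a variable is dropped.  Otherwise Q is
    c x_0 plus a polynomial Q' of smaller degree in the letters ad(x_0)^e(x_i):
    a test element m' supported at index 0 is killed by x_0 and detects Q',
    and one supported at index 1 detects c when Q' is zero. *)
Lemma detected_neq0 D n (Q : freeLie k n) : lie_le (@is_var n) D Q -> Q <> 0 -> detected Q.
Proof.
elim: D n Q => [n Q /lie_le0 -> //|D IHD]; elim=> [|n IHn] Q leQ Q0.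
  case: Q0; elim: leQ => // [_ [[]] //|a b P {}Q _ -> _ _|a c P {}Q _ -> _ ->].
    exact: lie0l.
  by rewrite scaler0 addr0.
have [/IHn|] := pselect (kill0 Q <> 0).
  case/(_ (kill0_le leQ)) => L [r [m Qm]].
  exists L, (fun i => if unlift ord0 i is Some j then r j else 0), m.
  congr (_ <> _): Qm; congr lie_bracket; rewrite /kill0 lie_eval_comp; apply: eq_lie_eval => i.
  by case: unliftP => [j _|_]; rewrite ?lie_eval_var ?linear0.
move/contrapT => killQ.
have [c [S [leS QE]]] := elimination_split leQ.
rewrite killQ /raise linear0 add0r in QE.
have [N [Q' [leQ' SE]]] := from_iter_ad_onto leS.
have [Q'0|/(IHD _ _ leQ')[L [r [m Qm]]]] := pselect (Q' = 0); last first.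
  pose m' : current L := (0, fun i => if i is 0%N then m else 0).
  exists (current L), (current_assign r), m'.
  rewrite QE linearD linearZ /= lie_eval_var lieDl lieZl {1}/current_assign unlift_none.
  rewrite cbr_derivation -SE; have [f -> f0] := from_iter_ad_current r Q'.
  move/(congr1 (fun u : current L => u.2 0%N)).
  rewrite -[LHS]/(c *: (1 *: 0) + (0 *: _ - 0 *: _ + [Lie f 0%N, m])).
  by rewrite !scaler0 !scale0r subrr !add0r f0.
have c0 : c != 0.
  apply: contra_notN Q0 => /eqP c0.
  by rewrite QE c0 scale0r add0r -SE Q'0 /from_iter_ad linear0.
pose m' : current abelian_line := (0, fun i => if i is 1%N then 1 else 0).
exists (current abelian_line), (fun i => if unlift ord0 i is Some j then 0 else (1, fun=> 0)), m'.
rewrite QE -SE Q'0 /from_iter_ad linear0 addr0 linearZ /= lie_eval_var unlift_none lieZl.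
rewrite cbr_derivation => /(congr1 (fun u : current abelian_line => u.2 0%N)).
rewrite -[LHS]/(c *: (1 *: (1 : k^o))) scale1r => /eqP.
by rewrite scaler_eq0 (negbTE c0) oner_eq0.
Qed.

End Filtration.

(** * Alternating sums of products, and separation of words *)

Section Standard.
Variables (k : fieldType) (L : lmodType k) (m : nat).
Implicit Types F : 'I_m -> {linear L -> L}.

(** The standard polynomial of the operators F_i, applied to z. *)
Definition standard (F : 'I_m -> L -> L) (z : L) : L :=
  \sum_(s : 'S_m) (-1) ^+ s *: foldr (fun i y => F (s i) y) z (enum 'I_m).

Lemma eq_standard F G z : (forall i, F i =1 G i) -> standard F z = standard G z.
Proof.
move=> FG; apply: eq_bigr => s _; congr (_ *: _).
by elim: (enum _) => //= i r ->; rewrite FG.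
Qed.

Lemma standard_alternate F i1 i2 z : i1 != i2 -> F i1 =1 F i2 -> standard F z = 0.
Proof.
move=> n12 F12; pose t := tperm i1 i2.
have oddMt s : (s * t)%g = ~~ s :> bool by rewrite odd_permM odd_tperm n12 addbT.
rewrite /standard [LHS](bigID (@odd_perm _)) /=.
apply: canLR (subrK _) _; rewrite add0r -sumrN.
rewrite (reindex_inj (mulIg t)); apply: eq_big => //= s.
rewrite oddMt => /negPf->; rewrite expr0 expr1 scale1r scaleN1r; congr (- _).
elim: (enum _) => //= i r ->; rewrite permM /t.
by case: tpermP => // ->; rewrite F12.
Qed.

Lemma foldr_enum_linear F (c : 'I_m -> k) i0 (s : 'S_m) z :
  (forall y, \sum_i c i *: F i y = 0) ->
  \sum_i c i *: foldr (fun j y => (if s j == i0 then F i else F (s j)) y) z (enum 'I_m) = 0.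
Proof.
move=> cF; pose j0 := (s^-1)%g i0.
have := enum_uniq 'I_m; case/splitPr: (mem_enum 'I_m j0) => r1 r2.
rewrite cat_uniq /= negb_or => /and3P[_ /andP[j0r1 _] /andP[j0r2 _]].
have sj0 : s j0 = i0 by rewrite permKV.
have foldE i r y : j0 \notin r ->
    foldr (fun j y => (if s j == i0 then F i else F (s j)) y) y r = foldr (fun j => F (s j)) y r.
  elim: r => //= j r IHr; rewrite inE negb_or => /andP[j0j /IHr ->].
  by rewrite -sj0 (inj_eq perm_inj) eq_sym (negbTE j0j).
have foldL r : linear (fun y => foldr (fun j => F (s j)) y r).
  by move=> a x y; elim: r => //= j r ->; rewrite linearP.
pose T : {linear L -> L} := HB.pack_for {linear L -> L}
  (fun y => foldr (fun j => F (s j)) y r1)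
  (GRing.isLinear.Build k L L *:%R _ (foldL r1)).
transitivity (T (\sum_i c i *: F i (foldr (fun j => F (s j)) z r2))).
  rewrite linear_sum; apply: eq_bigr => i _.
  by rewrite linearZ; congr (_ *: _); rewrite foldr_cat /= sj0 eqxx !foldE.
by rewrite cF linear0.
Qed.

(** Replace F_i0 by each F_i in turn.  The sum of all the results, weighted by c,
    is zero; for i different from i0 the result has a repeated operator and
    vanishes, which leaves c_i0 times the standard polynomial. *)
Lemma standard_dependent F (c : 'I_m -> k) i0 z : c i0 != 0 ->
  (forall y, \sum_i c i *: F i y = 0) -> standard F z = 0.
Proof.
move=> c0 cF.
pose G i j : L -> L := if j == i0 then F i else F j.
have G0 i : i != i0 -> standard (G i) z = 0.
  move=> ii0; apply: (@standard_alternate (fun j => if j == i0 then F i else F j) i i0) => //.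
  by move=> y /=; rewrite eqxx (negbTE ii0).
have : \sum_i c i *: standard (G i) z = 0.
  rewrite /standard; under eq_bigr do rewrite scaler_sumr.
  rewrite exchange_big big1 // => s _.
  under eq_bigr do rewrite scalerA mulrC -scalerA.
  by rewrite -scaler_sumr foldr_enum_linear ?scaler0.
rewrite (bigD1 i0) //= big1 ?addr0 => [/eqP|i /G0->]; last by rewrite scaler0.
rewrite scaler_eq0 (negbTE c0) /= => /eqP <-; apply: eq_standard => i y.
by rewrite /G; case: eqP => [->|].
Qed.

End Standard.

Section Commutator.
Variables (k : fieldType) (m : nat).
Implicit Types x y z : 'M[k]_m.+1.

Definition commutator x y := x * y - y * x.

Fact commutator_linl y (a : k) x x' :
  commutator (a *: x + x') y = a *: commutator x y + commutator x' y.
Proof.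
by rewrite /commutator mulrDl mulrDr -!scalerAl -scalerAr opprD addrACA scalerBr.
Qed.
Fact commutator_linr x (a : k) y y' :
  commutator x (a *: y + y') = a *: commutator x y + commutator x y'.
Proof.
by rewrite /commutator mulrDl mulrDr -!scalerAl -scalerAr opprD addrACA scalerBr.
Qed.
Fact commutatorxx x : commutator x x = 0. Proof. exact: subrr. Qed.
Fact commutator_jacobi x y z :
  commutator x (commutator y z) + commutator y (commutator z x)
    + commutator z (commutator x y) = 0.
Proof.
rewrite /commutator !mulrBr !mulrBl !mulrA !opprB !addrA.
rewrite (ACl ((1*12)*(2*7)*(3*10)*(4*5)*(6*11)*(8*9))%AC) /=.
by rewrite !(subrr, addNr) !addr0.
Qed.

HB.instance Definition _ := Lmodule_isLieAlgebra.Build k 'M[k]_m.+1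
  commutator_linl commutator_linr commutatorxx commutator_jacobi.

End Commutator.

(** Matrix units along a path: the letter W_j sends the basis vector j + 1 to j,
    and y has its single entry in the last column, so that brackets with y are
    products. *)
Lemma word_separation (k : fieldType) (A : eqType) (W : seq A) :
  exists (L : lieAlgType k) (r : A -> L) (y : L), forall s : seq A,
    size s = size W -> (ad_word r s y != 0) = (s == W).
Proof.
pose l := size W; pose E i j : 'M[k]_l.+2 := delta_mx (inord i) (inord j).
pose h a : 'M[k]_l.+2 := \matrix_(i, j) ((j == i.+1 :> nat) && (onth W i == Some a))%:R.
pose y := E l l.+1.
have hE a i : (i < l)%N ->
    [Lie h a, E i.+1 l.+1] = if onth W i == Some a then E i l.+1 else 0.
  move=> il; rewrite -[LHS]/(h a *m E i.+1 l.+1 - E i.+1 l.+1 *m h a).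
  have -> : E i.+1 l.+1 *m h a = 0.
    apply/matrixP => p q; rewrite !mxE big1 // => j _; rewrite !mxE.
    have [jl|] := eqVneq j (inord l.+1); last by rewrite andbF mul0r.
    rewrite jl inordK // onth_default ?andbF ?mulr0 //.
  rewrite subr0; apply/matrixP => p q; rewrite mxE (bigD1 (inord i.+1)) //= big1 ?addr0; last first.
    by move=> j /negbTE ji; rewrite !mxE ji mulr0.
  have il1 : nat_of_ord (inord i.+1 : 'I_l.+2) = i.+1 by rewrite (@inordK l.+1) // ltnS ltnW.
  have il0 : nat_of_ord (inord i : 'I_l.+2) = i by rewrite (@inordK l.+1) // ltnW // ltnW.
  have -> : h a p (inord i.+1) = ((p == inord i) && (onth W i == Some a))%:R.
    have -> : (p == inord i) = (i == p :> nat).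
      by apply/eqP/eqP => [->|pi]; [rewrite il0|apply: val_inj; rewrite [RHS]il0].
    by rewrite mxE il1 eqSS; case: eqP => [->|].
  have -> : E i.+1 l.+1 (inord i.+1) q = (q == inord l.+1)%:R by rewrite mxE eqxx.
  case: (onth W i == Some a); rewrite mxE.
    by rewrite andbT -natrM mulnb.
  by rewrite andbF mul0r.
have main s : (size s <= l)%N ->
    ad_word h s y = if s == drop (l - size s) W then E (l - size s)%N l.+1 else 0.
  elim: s => [|a s IHs] /= sl; first by rewrite subn0 drop_size eqxx.
  rewrite IHs ?(ltnW sl) //.
  have -> : (l - size s = (l - (size s).+1).+1)%N by rewrite subnSK.
  have lt_l : (l - (size s).+1 < l)%N by rewrite -subSn // subSS leq_subr.
  have [x xE] : exists x, onth W (l - (size s).+1) = Some x.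
    by have := onthTE W (l - (size s).+1); rewrite lt_l; case: onth => // x; exists x.
  rewrite (drop_nth x lt_l) (@onth_nth _ x x W _ xE) eqseq_cons andbC.
  case: eqP => [_|_] /=; last by rewrite lie0r.
  by rewrite hE // xE; congr (if _ then _ else _); rewrite eq_sym.
exists ('M[k]_l.+2 : lieAlgType k), h, y => s sW; rewrite main ?sW // subnn drop0.
case: (s == W) => /=; last by rewrite eqxx.
apply/eqP => /matrixP/(_ (inord 0) (inord l.+1)); rewrite !mxE !eqxx /= => /eqP.
by rewrite oner_eq0.
Qed.

(** * Linear dependence of words *)

Lemma linear_system_solution (k : fieldType) (I K : finType) (C : I -> K -> k) :
  (#|K| < #|I|)%N ->
  exists c : I -> k, (exists i, c i != 0) /\ forall x, \sum_i c i * C i x = 0.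
Proof.
move=> KI; pose A : 'M[k]_(#|I|, #|K|) := \matrix_(i, j) C (enum_val i) (enum_val j).
have : kermx A != 0.
  by rewrite kermx_eq0 -row_leq_rank -ltnNge (leq_ltn_trans (rank_leq_col A)).
case/rowV0Pn => v /sub_kermxP vA v0.
exists (fun i => v 0 (enum_rank i)); split.
  have [i vi] : exists i, v 0 i != 0.
    apply: contrapT => nex; case/eqP: v0; apply/rowP => i; rewrite mxE.
    by apply: contrapT => /eqP vi; apply: nex; exists i.
  by exists (enum_val i); rewrite enum_valK.
move=> x; transitivity ((v *m A) 0 (enum_rank x)); last by rewrite vA mxE.
rewrite mxE (reindex _ (onW_bij _ (@enum_val_bij I))) /=; apply: eq_bigr => i _.
by rewrite enum_valK mxE enum_rankK.
Qed.

Section Expansion.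
Variables (k : fieldType) (L : lieAlgType k) (I B : finType).
Variables (cf : B -> k) (elt : B * I -> L).

(** Distributivity for words whose letters are linear combinations. *)
Lemma ad_word_expand l (q : seq I -> k) z :
  \sum_(w : l.-tuple I) q w *: ad_word (fun i => \sum_b cf b *: elt (b, i)) w z =
  \sum_(u : l.-tuple (B * I)%type) (q (map snd u) * \prod_(s <- u) cf s.1) *: ad_word elt u z.
Proof.
elim: l q => [|l IHl] q.
  rewrite (@sum_words_nil _ _ (fun w => q w *: ad_word _ w z)).
  rewrite (@sum_words_nil _ _ (fun u => (q (map snd u) * \prod_(s <- u) cf s.1) *: ad_word elt u z)) /=.
  by rewrite big_nil mulr1.
rewrite (@sum_words_cons _ _ _ (fun w => q w *: ad_word _ w z)).
rewrite (@sum_words_cons _ _ _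
  (fun u => (q (map snd u) * \prod_(s <- u) cf s.1) *: ad_word elt u z)).
pose G b i := \sum_(u : l.-tuple (B * I)%type)
  (q (map snd ((b, i) :: u)) * \prod_(s <- (b, i) :: u) cf s.1) *: ad_word elt ((b, i) :: u) z.
transitivity (\sum_(p : B * I) G p.1 p.2); last by apply: eq_bigr => -[].
rewrite -(pair_bigA _ G) exchange_big /=; apply: eq_bigr => i _; rewrite /G /=.
under eq_bigr do rewrite -lieZr.
rewrite -lie_sumr (IHl (fun w => q (i :: w))) lie_suml; apply: eq_bigr => b _.
rewrite lie_sumr; apply: eq_bigr => u _.
by rewrite lieZl lieZr scalerA big_cons mulrCA mulrA.
Qed.

End Expansion.

Section Dependence.
Variables (k : closedFieldType) (c d n : nat).
Local Notation d1 := d.+1.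

Let B := ('I_d1 + 'I_c.+1)%type.
(* The words of length at most d, in letters that carry a slot (left) or one of
   the vectors eta (right), together with a component of the power L^n. *)
Let U := {l : 'I_d1.+1 & l.-tuple (B * 'I_n)%type}.

(** The number M of copies per slot, large enough for the words that miss a
    slot to be fewer than the assignments of a copy to each slot. *)
Definition copies := (#|{: U}| * d1).+1.
Local Notation M := copies.

Definition letter := ('I_d1 * 'I_M * 'I_n)%type.
Definition dword := (d1.-tuple letter)%type.

Let uword (p : U) : seq (B * 'I_n) := tagged p.

Let uword_inj : injective uword.
Proof.
move=> [l u] [l' u']; rewrite /uword /= => uu'.
have ll' : l = l' by apply: val_inj; rewrite /= -(size_tuple u) uu' size_tuple.
by case: l' / ll' u' uu' => u' uu'; congr existT; apply: val_inj.
Qed.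

(* As a full word has at most d letters, it contains each slot exactly once and
   no eta. *)
Let full (p : U) := [forall a : 'I_d1, inl a \in map fst (uword p)].

Let full_inl p s : full p -> s \in uword p -> exists a, s.1 = inl a.
Proof.
move=> /forallP fp sp.
pose inls : seq B := [seq inl a | a <- enum 'I_d1].
have sinls : size inls = d1 by rewrite size_map; exact: size_enum_ord.
have uinl : uniq inls by rewrite map_inj_uniq ?enum_uniq // => a b [].
have sub : {subset inls <= map fst (uword p)} by move=> _ /mapP[a _ ->].
have sz : (size (map fst (uword p)) <= size inls)%N.
  by rewrite size_map sinls /uword size_tuple -ltnS ltn_ord.
have [_ eq_inl] := uniq_min_size uinl sub sz.
have : s.1 \in inls by rewrite eq_inl map_f.
by case/mapP => a _ ->; exists a.
Qed.

Let full_size p : full p -> size (uword p) = d1.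
Proof.
move=> /forallP fp.
pose inls : seq B := [seq inl a | a <- enum 'I_d1].
have sinls : size inls = d1 by rewrite size_map; exact: size_enum_ord.
have uinl : uniq inls by rewrite map_inj_uniq ?enum_uniq // => a b [].
have sub : {subset inls <= map fst (uword p)} by move=> _ /mapP[a _ ->].
apply/eqP; rewrite eqn_leq; apply/andP; split; first by rewrite /uword size_tuple -ltnS ltn_ord.
by have := uniq_leq_size uinl sub; rewrite sinls size_map.
Qed.

Section Algebra.
Variables (L : lieAlgType k) (h : letter -> L).
Variable Q : freeLie k n.
Variable qf : nat -> seq 'I_n -> k.
Hypothesis QE : forall (r : 'I_n -> L) y, [Lie lie_eval r Q, y] =
  \sum_(l < d1.+1) \sum_(w : l.-tuple 'I_n) qf l w *: ad_word r w y.
Hypothesis qd : exists w : d1.-tuple 'I_n, qf d1 w != 0.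
Hypothesis cod : codim_le c (solution_set Q L).

(** Combine the relations Q(t_J + y_J eta) = 0 so that all the words missing a slot
    cancel; what is left is a relation between words in the letters h. *)
Lemma words_dependent : exists lam : dword -> k,
  (exists w, lam w != 0) /\ forall z, \sum_w lam w *: ad_word h w z = 0.
Proof.
pose Jt := {ffun 'I_d1 -> 'I_M}.
pose t (J : Jt) : {ffun 'I_n -> L} := [ffun i => \sum_a h (a, J a, i)].
have [eta etaP] := codim_translates cod t.
have {etaP} /choice[y yP] := etaP.
pose elt (J : 'I_d1 -> 'I_M) (s : B * 'I_n) : L :=
  match s.1 with inl a => h (a, J a, s.2) | inr i => eta i s.2 end.
pose cf J (b : B) : k := match b with inl _ => 1 | inr i => y J i end.
pose g J (p : U) := qf (tag p) (map snd (uword p)) * \prod_(s <- uword p) cf J s.1.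
have expand J z : \sum_p g J p *: ad_word (elt J) (uword p) z = 0.
  have tE i : (t J + \sum_i y J i *: eta i) i = \sum_b cf J b *: elt J (b, i).
    rewrite big_sumType /= !ffunE sum_ffunE; congr (_ + _).
      by apply: eq_bigr => a _; rewrite scale1r.
    by apply: eq_bigr => l _; rewrite ffunE.
  have := QE (fun i => \sum_b cf J b *: elt J (b, i)) z.
  rewrite -(eq_lie_eval tE) (yP J) lie0l => /esym.
  under eq_bigr do rewrite ad_word_expand.
  by rewrite (sig_big_dep _ _).
pose ext a (J' : {ffun 'I_d -> 'I_M}) (b : 'I_d1) : 'I_M :=
  if unlift a b is Some b' then J' b' else ord0.
pose restr a (J : Jt) : {ffun 'I_d -> 'I_M} := [ffun b => J (lift a b)].
pose miss (p : U) : 'I_d1 := odflt ord0 [pick a | inl a \notin map fst (uword p)].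
(* The values of words that are not full are indexed by the word, a missed slot
   and the restriction of J to the other slots. *)
pose K := (U * 'I_d1 * {ffun 'I_d -> 'I_M})%type.
pose C (J : Jt) (x : K) := if [&& ~~ full x.1.1, x.1.2 == miss x.1.1 & x.2 == restr (miss x.1.1) J]
   then g J x.1.1 else 0.
have ltK : (#|{: K}| < #|{: Jt}|)%N.
  rewrite !card_prod !card_ffun !card_ord expnS ltn_pmul2r ?expn_gt0 //.
have [lam [[J0 lam0] lamC]] := linear_system_solution C ltK.
have ad_word_miss (J : Jt) p z : ~~ full p ->
    ad_word (elt J) (uword p) z = ad_word (elt (ext (miss p) (restr (miss p) J))) (uword p) z.
  move=> nfp; have missP : inl (miss p) \notin map fst (uword p).
    rewrite /miss; case: pickP => //= allp; case/negP: nfp.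
    by apply/forallP => a; have := allp a; case: (_ \in _).
  elim: (uword p) missP => //= s u IHu; rewrite inE negb_or => /andP[ms /IHu ->].
  congr [Lie _, _]; rewrite /elt; case: s.1 ms => // a ma.
  congr (h (_, _, _)); rewrite /ext; case: unliftP => [b ->|am]; first by rewrite ffunE.
  by rewrite am eqxx in ma.
pose X (x : K) z := ad_word (elt (ext x.1.2 x.2)) (uword x.1.1) z.
have nonfull J z : \sum_(p | ~~ full p) g J p *: ad_word (elt J) (uword p) z = \sum_x C J x *: X x z.
  pose slot p : K := (p, miss p, restr (miss p) J).
  rewrite [RHS](eq_bigr (fun x : K => if [&& ~~ full x.1.1, x.1.2 == miss x.1.1 &
      x.2 == restr (miss x.1.1) J] then g J x.1.1 *: X x z else 0)); last first.
    by move=> x _; rewrite /C; case: ifP => _ //; rewrite scale0r.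
  rewrite -big_mkcond /= (reindex_onto slot (fun x => x.1.1)) /=; last first.
    by move=> [[p a] J'] /= /and3P[_ /eqP-> /eqP->].
  apply: eq_big => [p|p nfp]; first by rewrite !eqxx !andbT.
  by rewrite ad_word_miss.
have fullsum z : \sum_J \sum_(p | full p) (lam J * g J p) *: ad_word (elt J) (uword p) z = 0.
  transitivity (- \sum_x (\sum_J lam J * C J x) *: X x z); last first.
    by rewrite big1 ?oppr0 // => x _; rewrite lamC scale0r.
  under [in RHS]eq_bigr do rewrite scaler_suml.
  rewrite [in RHS]exchange_big /= -sumrN; apply: eq_bigr => J _.
  transitivity (lam J *: \sum_(p | full p) g J p *: ad_word (elt J) (uword p) z).
    by rewrite scaler_sumr; apply: eq_bigr => p _; rewrite scalerA.
  have := expand J z; rewrite (bigID full) /= nonfull => /(canRL (addrK _)) ->.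
  rewrite add0r scalerN scaler_sumr; congr (- _); apply: eq_bigr => x _.
  by rewrite scalerA.
pose wordJ (J : Jt) (s : B * 'I_n) : letter :=
  match s.1 with inl a => (a, J a, s.2) | inr _ => (ord0, J ord0, s.2) end.
have ad_word_full (J : Jt) p z : full p -> ad_word (elt J) (uword p) z = ad_word h (map (wordJ J) (uword p)) z.
  move=> /full_inl; elim: (uword p) => //= s u IHu inlP.
  rewrite IHu => [|s' s'u]; last by apply: inlP; rewrite inE s'u orbT.
  have [a sa] := inlP s (mem_head _ _).
  by rewrite /elt /wordJ sa.
pose Lam (w : dword) := \sum_J \sum_(p | full p)
  (if map (wordJ J) (uword p) == w then lam J * g J p else 0).
exists Lam; split; last first.
  move=> z; rewrite -[RHS](fullsum z) /Lam.
  under eq_bigr do rewrite scaler_suml.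
  rewrite exchange_big; apply: eq_bigr => J _ /=.
  under eq_bigr do rewrite scaler_suml.
  rewrite exchange_big; apply: eq_bigr => p fp /=.
  have sz : size (map (wordJ J) (uword p)) == d1 by rewrite size_map full_size.
  rewrite (bigD1 (Tuple sz)) //= eqxx big1 ?addr0 ?ad_word_full // => w.
  by rewrite -val_eqE /= eq_sym => /negbTE ->; rewrite scale0r.
have [w qw] := qd.
have [p0 p0E] : exists p0 : U, uword p0 = [seq (inl a, tnth w a) | a <- enum 'I_d1].
  have sz : size [seq (inl a, tnth w a) : B * 'I_n | a <- enum 'I_d1] == d1.
    by rewrite size_map size_enum_ord.
  by exists (Tagged (fun l : 'I_d1.+1 => l.-tuple (B * 'I_n)%type) (i := ord_max) (Tuple sz)).
have full0 : full p0.
  apply/forallP => a; apply/mapP; exists (inl a, tnth w a) => //.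
  by rewrite p0E map_f // mem_enum.
have sz0 : size (map (wordJ J0) (uword p0)) == d1 by rewrite size_map full_size.
exists (Tuple sz0).
(* A full word and the assignment J can be read off from the word in the letters
   h, so no cancellation affects the coefficient of the chosen word. *)
have back (J : Jt) p : full p -> uword p = map (fun l : letter => (inl l.1.1, l.2)) (map (wordJ J) (uword p)).
  move=> /full_inl inlP; rewrite -map_comp -[LHS]map_id; apply/eq_in_map => s /inlP[a].
  by rewrite /wordJ /=; case: s => b i /= ->.
rewrite /Lam (bigD1 J0) //= [X in _ + X]big1 ?addr0 => [|J JJ0]; last first.
  apply: big1 => p fp; case: eqP => // Jp; case/eqP: JJ0; apply/ffunP => a.
  have pp0 : uword p = uword p0 by rewrite (back J p fp) (back J0 p0 full0) Jp.
  move: Jp; rewrite pp0 => /eq_in_map /(_ (inl a, tnth w a)).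
  rewrite p0E map_f ?mem_enum // => /(_ isT) [].
  by [].
rewrite (bigD1 p0) //= eqxx big1 ?addr0 => [|p /andP[fp pp0]]; last first.
  case: eqP => // Jp; case/eqP: pp0; apply: uword_inj.
  by rewrite (back J0 p fp) (back J0 p0 full0) Jp.
rewrite mulf_neq0 // /g mulf_neq0 //.
  have -> : map snd (uword p0) = w.
    by rewrite p0E -map_comp /=; exact: map_tnth_enum.
  have -> : tag p0 = d1 :> nat by rewrite -[RHS](full_size full0) /uword size_tuple.
  exact: qw.
rewrite p0E big_map big1 ?oner_neq0 //.
Qed.

End Algebra.
End Dependence.

(** * The identity *)

Section Identity.
Variables (k : fieldType) (A : finType) (d : nat).
Local Notation m := #|{: d.-tuple A}|.

Definition word_standard (L : lieAlgType k) (h : A -> L) (y : L) : L :=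
  standard (fun i : 'I_m => ad_word h (enum_val i : d.-tuple A)) y.

Definition word_identity : freeLie k #|{: option A}| :=
  word_standard (fun a => free_var k (enum_rank (Some a))) (free_var k (enum_rank None)).

Lemma lie_eval_word_identity (L : lieAlgType k) (r : 'I_#|{: option A}| -> L) :
  lie_eval r word_identity =
  word_standard (fun a => r (enum_rank (Some a))) (r (enum_rank None)).
Proof.
rewrite /word_identity /word_standard /standard linear_sum; apply: eq_bigr => s _.
rewrite linearZ /=; congr (_ *: _).
elim: (enum 'I_m) => /= [|i u <-]; first by rewrite lie_eval_var.
by elim: (tval _) => //= a w IHw; rewrite lie_eval_br IHw lie_eval_var.
Qed.

Lemma foldr_ad_word (I : Type) (L : lieAlgType k) (h : A -> L) (w : I -> seq A) y u :
  foldr (fun i => ad_word h (w i)) y u = ad_word h (flatten (map w u)) y.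
Proof. by elim: u => //= i u ->; rewrite ad_word_cat. Qed.

(** Evaluate where the concatenation of all words in their given order acts
    nontrivially and all other concatenations act as zero: different orders
    concatenate to different words since the pieces have equal lengths. *)
Lemma word_identity_neq0 : word_identity <> 0.
Proof.
pose w (s : 'S_m) (i : 'I_m) : seq A := (enum_val (s i) : d.-tuple A).
pose cat s := flatten (map (w s) (enum 'I_m)).
have shapeE s : shape (map (w s) (enum 'I_m)) = nseq m d.
  rewrite -[in RHS](size_enum_ord m).
  by elim: (enum 'I_m) => //= i u ->; rewrite size_tuple.
have cat_inj s s' : cat s = cat s' -> s = s'.
  move=> ss'; have : map (w s) (enum 'I_m) = map (w s') (enum 'I_m).
    by rewrite -[LHS]flattenK -[RHS]flattenK -/(cat s) -/(cat s') ss' !shapeE.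
  move/eq_in_map => ww; apply/permP => i; apply: enum_val_inj; apply: val_inj.
  by apply: ww; rewrite mem_enum.
have sz s : size (cat s) = size (cat 1%g) by rewrite !size_flatten !shapeE.
have [L [r [y yP]]] := word_separation k (cat 1%g).
move/(congr1 (lie_eval (fun i => if enum_val i is Some a then r a else y))).
rewrite linear0 lie_eval_word_identity !enum_rankK /word_standard /standard.
rewrite (eq_bigr (fun s : 'S_m => (-1) ^+ s *: ad_word r (cat s) y)); last first.
  by move=> s _; rewrite -foldr_ad_word; congr (_ *: foldr _ _ _); apply/funext => i;
    apply/funext => z; apply: eq_ad_word => a; rewrite enum_rankK.
rewrite (bigD1 1%g) //= big1 ?addr0 => [|s s1]; last first.
  have := yP _ (sz s); rewrite (_ : (cat s == cat 1%g) = false).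
    by move/negbFE/eqP ->; rewrite scaler0.
  by apply: contraNF s1 => /eqP/cat_inj ->.
apply/eqP; rewrite odd_perm1 expr0 scale1r yP //; exact: eqxx.
Qed.

End Identity.

Theorem mainTheorem3 (k : closedFieldType) (c d n : nat)
    (hc : (0 < c)%N) (hd : (0 < d)%N) (hn : (0 < n)%N) :
  exists (m : nat) (P : freeLie k m), P <> 0%R /\
    forall (Q : freeLie k n), Q <> 0%R -> lie_degree Q d ->
    forall (L : lieAlgType k),
      is_identity P L \/ ~ codim_le c (solution_set Q L).
Proof.
case: d hd => // d _.
exists _, (word_identity k (letter c d n) d.+1); split; first exact: word_identity_neq0.
move=> Q _ [q [q_hom QE qd]] L.
have [cod|] := pselect (codim_le c (solution_set Q L)); [left|by right].
move=> r; rewrite lie_eval_word_identity /word_standard.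
pose h (a : letter c d n) := r (enum_rank (Some a)).
have /choice[qf qfP] l := lie_homog_words (q_hom l).
have QwE (s : 'I_n -> L) z : [Lie lie_eval s Q, z] =
    \sum_(l < d.+2) \sum_(w : l.-tuple 'I_n) qf l w *: ad_word s w z.
  rewrite QE linear_sum lie_suml; apply: eq_bigr => l _; exact: qfP.
have qdw : exists w : d.+1.-tuple 'I_n, qf d.+1 w != 0.
  have [L' [s [z]]] := detected_neq0 (lie_homog_le (q_hom d.+1)) (elimN eqP qd).
  rewrite qfP => nz; apply: contrapT => nex; apply: nz; apply: big1 => w _.
  rewrite (_ : qf d.+1 w = 0) ?scale0r //; apply: contrapT => /eqP qw.
  by apply: nex; exists w.
have [lam [[w0 lam0] lamP]] := words_dependent h QwE qdw cod.
apply: (@standard_dependent _ _ _ (fun i => ad_word h (enum_val i : d.+1.-tuple _))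
  (fun i => lam (enum_val i)) (enum_rank w0)); first by rewrite enum_rankK.
move=> z; rewrite -[RHS](lamP z).
by rewrite [RHS](reindex _ (onW_bij _ (@enum_val_bij (dword c d n)))).
Qed.
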